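(* Let $\Gamma$ be the $\mathbb{Z}\times\mathbb{Z}_2^3$-grading on the Albert algebra $\mathcal{A}$ over an algebraically closed field $\mathbb{F}$ of characteristic different from $2$, as defined in the context. Then $W(\Gamma)=\mathrm{Aut}(\mathbb{Z}\times\mathbb{Z}_2^3)$.
   Context: Gradings and Weyl groups. For a grading $\Gamma:\mathcal{A}=\bigoplus_{g\in G}\mathcal{A}_g$ of a (nonassociative) algebra by an abelian group $G$ ($\mathcal{A}_g\mathcal{A}_h\subset\mathcal{A}_{g+h}$, additive notation), $\mathrm{Supp}\,\Gamma=\{g:\mathcal{A}_g\neq0\}$; $\mathrm{Aut}(\Gamma)$ is the group of algebra automorphisms of $\mathcal{A}$ permuting the nonzero components $\mathcal{A}_g$; $\mathrm{Stab}(\Gamma)$ is the subgroup of those leaving each component invariant; the Weyl group is $W(\Gamma)=\mathrm{Aut}(\Gamma)/\mathrm{Stab}(\Gamma)$. When $G$ is the universal abelian group of $\Gamma$ (i.e., for any realization of the same decomposition as a grading by an abelian group $H$ there is a unique homomorphism $G\to H$ restricting to the identity on the support), each $\varphi\in\mathrm{Aut}(\Gamma)$ induces a unique automorphism $u$ of $G$ with $\varphi(\mathcal{A}_s)=\mathcal{A}_{u(s)}$ for all $s\in\mathrm{Supp}\,\Gamma$, and in this way $W(\Gamma)$ is regarded as a subgroup of $\mathrm{Aut}(G)$. Cayley algebra. $\mathcal{C}$ is the $8$-dimensional algebra over $\mathbb{F}$ with basis $\{e_1,e_2,u_1,u_2,u_3,v_1,v_2,v_3\}$ and multiplication, indices of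 $u,v$ taken modulo $3$: $e_1^2=e_1$, $e_2^2=e_2$, $e_1e_2=e_2e_1=0$; $e_1u_i=u_i=u_ie_2$, $e_2v_i=v_i=v_ie_1$, $e_2u_i=u_ie_1=e_1v_i=v_ie_2=0$; $u_iv_i=-e_1$, $v_iu_i=-e_2$, $u_iv_j=v_iu_j=0$ for $i\ne j$; $u_i^2=v_i^2=0$; $u_iu_{i+1}=-u_{i+1}u_i=v_{i+2}$, $v_iv_{i+1}=-v_{i+1}v_i=u_{i+2}$. Its norm $n$ is the multiplicative quadratic form with polar form $n(x,y)=n(x+y)-n(x)-n(y)$, where all basis elements are isotropic, $n(e_1,e_2)=n(u_i,v_i)=1$, and all other pairs of distinct basis elements are orthogonal; $\bar x=n(x,1)1-x$, and $\mathcal{C}_0=\{x\in\mathcal{C}: n(x,1)=0\}$. $\mathbb{Z}_2^3$-grading on $\mathcal{C}$. Let $c_1,c_2,c_3$ be the standard basis of $\mathbb{Z}_2^3$. $\mathcal{C}$ is obtained by repeated Cayley--Dickson doubling: $\mathcal{K}=\mathbb{F}1\oplus\mathbb{F}w_1$, $\mathcal{Q}=\mathcal{K}\oplus\mathcal{K}w_2$, $\mathcal{C}=\mathcal{Q}\oplus\mathcal{Q}w_3$ with $w_i^2=1$; concretely one may take $w_1=e_1-e_2$, $w_2=u_1-v_1$, $w_3=u_2-v_2$. Setting $\deg w_i=c_i$ determines a $\mathbb{Z}_2^3$-grading on $\mathcal{C}$ with one-dimensional components. Albert algebra. $\mathcal{A}$ is the algebra of Hermitian $3\times3$ matrices $\begin{pmatrix}\alpha_1&\bar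 a_3&a_2\\ a_3&\alpha_2&\bar a_1\\ \bar a_2&a_1&\alpha_3\end{pmatrix}$ ($\alpha_i\in\mathbb{F}$, $a_i\in\mathcal{C}$) with product $XY=\frac12(X\cdot Y+Y\cdot X)$, where $X\cdot Y$ is the usual matrix product. $E_i$ denotes the matrix with $\alpha_i=1$ and all other parameters $0$; $\iota_i(a)$ denotes the matrix with $a_i=2a$ and all other parameters $0$. So $\mathcal{A}=\bigoplus_{i=1}^3(\mathbb{F}E_i\oplus\iota_i(\mathcal{C}))$, the $E_i$ are orthogonal idempotents with sum $1$, and (indices modulo 3) $E_i\iota_i(a)=0$, $E_{i+1}\iota_i(a)=\frac12\iota_i(a)=E_{i+2}\iota_i(a)$, $\iota_i(a)\iota_{i+1}(b)=\iota_{i+2}(\bar a\bar b)$, $\iota_i(a)\iota_i(b)=2n(a,b)(E_{i+1}+E_{i+2})$. The $\mathbb{Z}\times\mathbb{Z}_2^3$-grading on $\mathcal{A}$. Fix $\mathbf{i}\in\mathbb{F}$ with $\mathbf{i}^2=-1$ and put $E=E_1$, $\widetilde{E}=E_2+E_3$, $\nu(a)=\mathbf{i}\,\iota_1(a)$ for $a\in\mathcal{C}_0$, $\nu_\pm(x)=\iota_2(x)\pm\mathbf{i}\,\iota_3(\bar x)$ for $x\in\mathcal{C}$, and $S^\pm=E_3-E_2\pm\frac{\mathbf{i}}{2}\iota_1(1)$. These elements span $\mathcal{A}$, and $\Gamma$ is given by $\deg S^\pm=(\pm2,0)$, $\deg\nu_\pm(x)=(\pm1,\deg x)$, $\deg E=\deg\widetilde{E}=0$,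 $\deg\nu(a)=(0,\deg a)$, for nonzero homogeneous $x\in\mathcal{C}$ and $a\in\mathcal{C}_0$ with respect to the $\mathbb{Z}_2^3$-grading on $\mathcal{C}$ above. Its universal abelian group is $\mathbb{Z}\times\mathbb{Z}_2^3$. *)

(* Defs.v *)
From HB Require Import structures.
From mathcomp Require Import all_boot all_order all_algebra.
From mathcomp Require Import boolp ring.

Set Implicit Arguments.
Unset Strict Implicit.
Unset Printing Implicit Defensive.

Import GRing.Theory.
Local Open Scope ring_scope.

Section AlgebraAutomorphisms.
Variables (F : fieldType) (A : vectType F) (mul : A -> A -> A).

Record algaut := AlgAut {
  algaut_fun :> 'End(A);
  algaut_inj : lker algaut_fun == 0%VS;
  algaut_morph : {morph algaut_fun : x y / mul x y} }.

HB.instance Definition _ := gen_eqMixin algaut.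
HB.instance Definition _ := gen_choiceMixin algaut.

Lemma algaut_eq (f g : algaut) : f = g :> 'End(A) -> f = g.
Proof.
case: f g => [f fi fm] [g gi gm] /= E; rewrite -{}E in gi gm *.
by congr AlgAut; [exact: eq_irrelevance|exact: Prop_irrelevance].
Qed.

Fact algaut_one_inj : lker (\1%VF : 'End(A)) == 0%VS.
Proof. by apply/lker0P => x y; rewrite !id_lfunE. Qed.
Fact algaut_one_morph : {morph (\1%VF : 'End(A)) : x y / mul x y}.
Proof. by move=> x y; rewrite !id_lfunE. Qed.
Definition algaut_one := AlgAut algaut_one_inj algaut_one_morph.

Fact algaut_mul_inj (f g : algaut) : lker (f \o g)%VF == 0%VS.
Proof.
apply/lker0P => x y; rewrite !comp_lfunE.
by move=> /(lker0P (algaut_inj f)) /(lker0P (algaut_inj g)).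
Qed.
Fact algaut_mul_morph (f g : algaut) : {morph (f \o g)%VF : x y / mul x y}.
Proof. by move=> x y; rewrite !comp_lfunE !algaut_morph. Qed.
Definition algaut_mul (f g : algaut) :=
  AlgAut (algaut_mul_inj f g) (@algaut_mul_morph f g).

Fact algaut_inv_inj (f : algaut) : lker (f^-1)%VF == 0%VS.
Proof.
by apply/lker0P; apply: (can_inj (g := f)); exact: lker0_lfunVK (algaut_inj f).
Qed.
Fact algaut_inv_morph (f : algaut) : {morph (f^-1)%VF : x y / mul x y}.
Proof.
move=> x y; apply: (lker0P (algaut_inj f)).
by rewrite algaut_morph !(lker0_lfunVK (algaut_inj f)).
Qed.
Definition algaut_inv (f : algaut) :=
  AlgAut (algaut_inv_inj f) (@algaut_inv_morph f).

Fact algaut_mulA : associative algaut_mul.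
Proof. by move=> f g h; apply: algaut_eq; rewrite /= comp_lfunA. Qed.
Fact algaut_mul1 : left_id algaut_one algaut_mul.
Proof. by move=> f; apply: algaut_eq; rewrite /= comp_lfun1l. Qed.
Fact algaut_1mul : right_id algaut_one algaut_mul.
Proof. by move=> f; apply: algaut_eq; rewrite /= comp_lfun1r. Qed.
Fact algaut_mulV : left_inverse algaut_one algaut_inv algaut_mul.
Proof.
by move=> f; apply: algaut_eq; rewrite /= (lker0_compVf (algaut_inj f)).
Qed.
Fact algaut_Vmul : right_inverse algaut_one algaut_inv algaut_mul.
Proof.
by move=> f; apply: algaut_eq; rewrite /= (lker0_compfV (algaut_inj f)).
Qed.

HB.instance Definition _ :=
  isGroup.Build algaut algaut_mulA algaut_mul1 algaut_1mul
    algaut_mulV algaut_Vmul.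

End AlgebraAutomorphisms.

Section WeylGroup.
Variables (F : fieldType) (A : vectType F) (mul : A -> A -> A).
Variables (G : Type) (comp : G -> {vspace A}).

Definition gsupp (g : G) : bool := comp g != 0%VS.

(* the nonzero components are mapped to nonzero components, and each is reached *)
Definition permutes_components (f : algaut mul) : Prop :=
  (forall g, gsupp g -> exists2 h, gsupp h & (f @: comp g)%VS = comp h) /\
  (forall h, gsupp h -> exists2 g, gsupp g & (f @: comp g)%VS = comp h).

Definition gaut_pred : {pred algaut mul} :=
  fun f => `[< permutes_components f >].

Record gaut := GAut { gaut_val :> algaut mul; gautP : gaut_val \in gaut_pred }.

HB.instance Definition _ := [isSub for gaut_val].
HB.instance Definition _ := [Choice of gaut by <:].

Fact gaut_group_closed : group_closed gaut_pred.
Proof.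
have K (f : algaut mul) (U : {vspace A}) : ((f^-1)%g @: (f @: U))%VS = U.
  by rewrite -limg_comp (lker0_compVf (algaut_inj f)) lim1g.
split.
  by apply/asboolP; split=> g sg; exists g; rewrite //= lim1g.
move=> f h /asboolP[f1 f2] /asboolP[h1 h2]; apply/asboolP; split=> g sg.
- have [k sk kE] := h2 g sg; have [l sl lE] := f1 k sk.
  by exists l => //; rewrite /= limg_comp -kE K.
- have [k sk kE] := f2 g sg; have [l sl lE] := h1 k sk.
  by exists l => //; rewrite /= limg_comp -lE K.
Qed.

HB.instance Definition _ :=
  SubChoice_isSubGroup.Build (algaut mul) gaut_pred gaut gaut_group_closed.

Definition gstab : {pred gaut} :=
  fun f => `[< forall g, (f @: comp g)%VS = comp g >].

Fact gstab_group_closed : group_closed gstab.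
Proof.
have K (f : gaut) (U : {vspace A}) : ((f^-1)%g @: (f @: U))%VS = U.
  by rewrite -limg_comp (lker0_compVf (algaut_inj f)) lim1g.
split; first by apply/asboolP => g; rewrite /= lim1g.
move=> f h /asboolP fS /asboolP hS; apply/asboolP => g.
by rewrite /= limg_comp -{1}(hS g) K fS.
Qed.

Let gstab1 : 1%g \in gstab := gstab_group_closed.1.
Let gstabM := group_closedM gstab_group_closed.
Let gstabV := group_closedV gstab_group_closed.

Lemma gstabJ (f h : gaut) : f \in gstab -> (f ^ h)%g \in gstab.
Proof.
move=> /asboolP fS; apply/asboolP => g.
have K (U : {vspace A}) : ((h^-1)%g @: (h @: U))%VS = U.
  by rewrite -limg_comp (lker0_compVf (algaut_inj h)) lim1g.
have [h1 _] : permutes_components h := asboolW (gautP h).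
rewrite /= !limg_comp.
have [sg|/negPn/eqP ->] := boolP (gsupp g); last by rewrite !limg0.
by have [k _ kE] := h1 g sg; rewrite kE fS -kE K.
Qed.

Definition weyl_rel (f h : gaut) : bool := (f^-1 * h)%g \in gstab.

Fact weyl_rel_refl : reflexive weyl_rel.
Proof. by move=> f; rewrite /weyl_rel mulVg; exact: gstab1. Qed.
Fact weyl_rel_sym : symmetric weyl_rel.
Proof. by move=> f h; apply/idP/idP => /gstabV; rewrite invgM invgK. Qed.
Fact weyl_rel_trans : transitive weyl_rel.
Proof.
move=> f h k hf fk; rewrite /weyl_rel.
by have := gstabM hf fk; rewrite mulgA mulgK.
Qed.

Canonical weyl_equiv := EquivRel weyl_rel weyl_rel_refl weyl_rel_sym weyl_rel_trans.

Local Open Scope quotient_scope.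

(* Aut(Gamma) / Stab(Gamma), as the type of left cosets *)
Definition weyl := {eq_quot weyl_equiv}.

HB.instance Definition _ := Choice.on weyl.
HB.instance Definition _ := EqQuotient.on weyl.

Definition weyl_class (f : gaut) : weyl := \pi_weyl f.

Definition weyl_one : weyl := weyl_class 1%g.
Definition weyl_mul (x y : weyl) : weyl := weyl_class (repr x * repr y)%g.
Definition weyl_inv (x : weyl) : weyl := weyl_class (repr x)^-1%g.

Lemma weyl_classP (f h : gaut) :
  reflect (weyl_class f = weyl_class h) ((f^-1 * h)%g \in gstab).
Proof. exact: eqmodP. Qed.

Lemma weyl_classK (x : weyl) : weyl_class (repr x) = x.
Proof. exact: reprK. Qed.

Lemma weyl_class_surj (x : weyl) : exists f, x = weyl_class f.
Proof. by exists (repr x); rewrite weyl_classK. Qed.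

Lemma weyl_mulE f h : weyl_mul (weyl_class f) (weyl_class h) = weyl_class (f * h)%g.
Proof.
rewrite /weyl_mul; apply/weyl_classP.
set f' := repr _; set h' := repr _.
have /weyl_classP fS : weyl_class f' = weyl_class f by rewrite weyl_classK.
have /weyl_classP hS : weyl_class h' = weyl_class h by rewrite weyl_classK.
have -> : ((f' * h')^-1 * (f * h) = (f'^-1 * f) ^ h' * (h'^-1 * h))%g.
  by rewrite /conjg invgM !mulgA mulgK.
by apply: gstabM => //; exact: gstabJ.
Qed.

Lemma weyl_invE f : weyl_inv (weyl_class f) = weyl_class f^-1%g.
Proof.
rewrite /weyl_inv; apply/weyl_classP; set f' := repr _.
have /weyl_classP fS : weyl_class f = weyl_class f' by rewrite weyl_classK.
have -> : ((f'^-1)^-1 * f^-1 = (f^-1 * f') ^ f^-1)%g.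
  by rewrite /conjg !invgK !mulgA mulgV mul1g.
exact: gstabJ.
Qed.

Fact weyl_mulA : associative weyl_mul.
Proof.
move=> x y z; have [f ->] := weyl_class_surj x.
have [h ->] := weyl_class_surj y; have [k ->] := weyl_class_surj z.
by rewrite !weyl_mulE mulgA.
Qed.
Fact weyl_mul1 : left_id weyl_one weyl_mul.
Proof. by move=> x; have [f ->] := weyl_class_surj x; rewrite weyl_mulE mul1g. Qed.
Fact weyl_1mul : right_id weyl_one weyl_mul.
Proof. by move=> x; have [f ->] := weyl_class_surj x; rewrite weyl_mulE mulg1. Qed.
Fact weyl_mulV : left_inverse weyl_one weyl_inv weyl_mul.
Proof.
by move=> x; have [f ->] := weyl_class_surj x; rewrite weyl_invE weyl_mulE mulVg.
Qed.
Fact weyl_Vmul : right_inverse weyl_one weyl_inv weyl_mul.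
Proof.
by move=> x; have [f ->] := weyl_class_surj x; rewrite weyl_invE weyl_mulE mulgV.
Qed.

HB.instance Definition _ :=
  isGroup.Build weyl weyl_mulA weyl_mul1 weyl_1mul weyl_mulV weyl_Vmul.

End WeylGroup.

Arguments weyl_class {F A mul G comp} f.

Section AdditiveGroupAutomorphisms.
Variable G : zmodType.

Record zaut := ZAut {
  zaut_fun :> G -> G;
  zaut_morph : {morph zaut_fun : x y / x + y};
  zaut_bij : bijective zaut_fun }.

HB.instance Definition _ := gen_eqMixin zaut.
HB.instance Definition _ := gen_choiceMixin zaut.

Lemma zaut_eq (u v : zaut) : u =1 v -> u = v.
Proof.
case: u v => [u um ub] [v vm vb] /= /funext E; rewrite -{}E in vm vb *.
by congr ZAut; exact: Prop_irrelevance.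
Qed.

Fact zaut_one_morph : {morph @id G : x y / x + y}. Proof. by []. Qed.
Fact zaut_one_bij : bijective (@id G). Proof. by exists id. Qed.
Definition zaut_one := ZAut zaut_one_morph zaut_one_bij.

Fact zaut_mul_morph (u v : zaut) : {morph u \o v : x y / x + y}.
Proof. by move=> x y /=; rewrite !zaut_morph. Qed.
Definition zaut_mul (u v : zaut) :=
  ZAut (@zaut_mul_morph u v) (bij_comp (zaut_bij u) (zaut_bij v)).

Fact zaut_inv_subproof (u : zaut) : exists v, cancel u v /\ cancel v u.
Proof. by have [v uK vK] := zaut_bij u; exists v. Qed.
Definition zaut_inv_fun (u : zaut) := projT1 (cid (zaut_inv_subproof u)).
Fact zaut_funK (u : zaut) : cancel u (zaut_inv_fun u).
Proof. exact: (projT2 (cid (zaut_inv_subproof u))).1. Qed.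
Fact zaut_funVK (u : zaut) : cancel (zaut_inv_fun u) u.
Proof. exact: (projT2 (cid (zaut_inv_subproof u))).2. Qed.
Fact zaut_inv_morph (u : zaut) : {morph zaut_inv_fun u : x y / x + y}.
Proof. by move=> x y; apply: (can_inj (zaut_funK u)); rewrite zaut_morph !zaut_funVK. Qed.
Fact zaut_inv_bij (u : zaut) : bijective (zaut_inv_fun u).
Proof. by exists u; [exact: zaut_funVK|exact: zaut_funK]. Qed.
Definition zaut_inv (u : zaut) := ZAut (@zaut_inv_morph u) (zaut_inv_bij u).

Fact zaut_mulA : associative zaut_mul.
Proof. by move=> u v w; apply: zaut_eq. Qed.
Fact zaut_mul1 : left_id zaut_one zaut_mul.
Proof. by move=> u; apply: zaut_eq. Qed.
Fact zaut_1mul : right_id zaut_one zaut_mul.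
Proof. by move=> u; apply: zaut_eq. Qed.
Fact zaut_mulV : left_inverse zaut_one zaut_inv zaut_mul.
Proof. by move=> u; apply: zaut_eq => x; exact: zaut_funK. Qed.
Fact zaut_Vmul : right_inverse zaut_one zaut_inv zaut_mul.
Proof. by move=> u; apply: zaut_eq => x; exact: zaut_funVK. Qed.

HB.instance Definition _ :=
  isGroup.Build zaut zaut_mulA zaut_mul1 zaut_1mul zaut_mulV zaut_Vmul.

End AdditiveGroupAutomorphisms.

(* Indices modulo 3 are elements of 'Z_3, so that u_3 and v_3 are u_0 and v_0. *)
Variant cidx := IE1 | IE2 | IU of 'Z_3 | IV of 'Z_3.

Definition cidx_code (x : cidx) : bool + ('Z_3 + 'Z_3) :=
  match x with
  | IE1 => inl true | IE2 => inl false
  | IU i => inr (inl i) | IV i => inr (inr i)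
  end.
Definition cidx_decode (s : bool + ('Z_3 + 'Z_3)) : cidx :=
  match s with
  | inl b => if b then IE1 else IE2
  | inr (inl i) => IU i | inr (inr i) => IV i
  end.
Fact cidx_codeK : cancel cidx_code cidx_decode. Proof. by case. Qed.
HB.instance Definition _ := Finite.copy cidx (can_type cidx_codeK).

Section Cayley.
Variable F : fieldType.

Definition cay := {ffun cidx -> F^o}.
HB.instance Definition _ := Vector.on cay.

Definition cbasis (k : cidx) : cay := [ffun l => (l == k)%:R].
Definition cay_e1 := cbasis IE1.
Definition cay_e2 := cbasis IE2.
Definition cay_u (i : 'Z_3) := cbasis (IU i).
Definition cay_v (i : 'Z_3) := cbasis (IV i).

Definition cbasis_mul (k l : cidx) : cay :=
  match k, l with
  | IE1, IE1 => cay_e1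
  | IE2, IE2 => cay_e2
  | IE1, IU i | IU i, IE2 => cay_u i
  | IE2, IV i | IV i, IE1 => cay_v i
  | IU i, IV j => if i == j then - cay_e1 else 0
  | IV i, IU j => if i == j then - cay_e2 else 0
  | IU i, IU j => if j == i + 1 then cay_v (i + 2)
                  else if i == j + 1 then - cay_v (j + 2) else 0
  | IV i, IV j => if j == i + 1 then cay_u (i + 2)
                  else if i == j + 1 then - cay_u (j + 2) else 0
  | _, _ => 0
  end.

Definition cmul (x y : cay) : cay :=
  \sum_k \sum_l ((x k : F) * (y l : F)) *: cbasis_mul k l.

Definition cone : cay := cay_e1 + cay_e2.

Definition cnorm (x : cay) : F :=
  (x IE1 : F) * x IE2 + \sum_(i : 'Z_3) (x (IU i) : F) * x (IV i).

Definition cpolar (x y : cay) : F := cnorm (x + y) - cnorm x - cnorm y.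

Definition cconj (x : cay) : cay := cpolar x cone *: cone - x.

Lemma sum_Z3 (V : nmodType) (f : 'Z_3 -> V) : \sum_i f i = f 0 + f 1 + f 2.
Proof.
rewrite !big_ord_recl big_ord0 addr0 addrA.
by congr (f _ + f _ + f _); apply: val_inj.
Qed.

Lemma sum_cidx (V : nmodType) (f : cidx -> V) :
  \sum_k f k = f IE1 + f IE2 + \sum_i f (IU i) + \sum_i f (IV i).
Proof.
rewrite (reindex cidx_decode); last first.
  by exists cidx_code => s _; [case: s => [[]|[]]|exact: cidx_codeK].
by rewrite big_sumType big_bool big_sumType /= -!addrA.
Qed.

Lemma Z3P (P : 'Z_3 -> Prop) : P 0 -> P 1 -> P 2 -> forall i, P i.
Proof.
move=> P0 P1 P2 [[|[|[|//]]] lti].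
- by rewrite (_ : Ordinal _ = 0) //; apply: val_inj.
- by rewrite (_ : Ordinal _ = 1) //; apply: val_inj.
- by rewrite (_ : Ordinal _ = 2) //; apply: val_inj.
Qed.

Lemma cmul_coord x y m : cmul x y m =
  \sum_k \sum_l (x k : F) * (y l : F) * (cbasis_mul k l m : F) :> F.
Proof.
rewrite /cmul sum_ffunE; apply: eq_bigr => k _; rewrite sum_ffunE.
by apply: eq_bigr => l _; rewrite ffunE.
Qed.

Definition cmul_formula (x y : cay) (k : cidx) : F :=
  let c := fun (z : cay) k => z k : F in
  match k with
  | IE1 => c x IE1 * c y IE1 - \sum_i c x (IU i) * c y (IV i)
  | IE2 => c x IE2 * c y IE2 - \sum_i c x (IV i) * c y (IU i)
  | IU i => c x IE1 * c y (IU i) + c x (IU i) * c y IE2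
            + c x (IV (i + 1)) * c y (IV (i + 2))
            - c x (IV (i + 2)) * c y (IV (i + 1))
  | IV i => c x IE2 * c y (IV i) + c x (IV i) * c y IE1
            + c x (IU (i + 1)) * c y (IU (i + 2))
            - c x (IU (i + 2)) * c y (IU (i + 1))
  end.

Lemma sum_cidx8 (V : nmodType) (f : cidx -> V) :
  \sum_k f k = f IE1 + f IE2 + (f (IU 0) + f (IU 1) + f (IU 2)) + (f (IV 0) + f (IV 1) + f (IV 2)).
Proof. by rewrite sum_cidx !sum_Z3. Qed.

(* integral structure constants *)
Definition zcoef (k l m : cidx) : int :=
  let d n : int := if n == m then 1 else 0 in
  match k, l with
  | IE1, IE1 => d IE1
  | IE2, IE2 => d IE2
  | IE1, IU i | IU i, IE2 => d (IU i)
  | IE2, IV i | IV i, IE1 => d (IV i)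
  | IU i, IV j => if i == j then - d IE1 else 0
  | IV i, IU j => if i == j then - d IE2 else 0
  | IU i, IU j => if j == i + 1 then d (IV (i + 2))
                  else if i == j + 1 then - d (IV (j + 2)) else 0
  | IV i, IV j => if j == i + 1 then d (IU (i + 2))
                  else if i == j + 1 then - d (IU (j + 2)) else 0
  | _, _ => 0
  end.

Lemma zcoefE k l m : cbasis_mul k l m = (zcoef k l m)%:~R :> F.
Proof.
have E n : cbasis n m = (if n == m then 1 else 0 : int)%:~R :> F.
  by rewrite ffunE eq_sym; case: eqP.
have N n : (- cbasis n : cay) m = (- (if n == m then 1 else 0 : int))%:~R :> F.
  by rewrite ffunE E rmorphN.
have Z : (0 : cay) m = (0 : int)%:~R :> F by rewrite ffunE.
case: k l => [||i|i] [||j|j]; rewrite /zcoef /=; try exact: E; try exact: Z;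
  case: (i == j); case: (j == i + 1); case: (i == j + 1);
  first [exact: E | exact: N | exact: Z].
Qed.

Lemma cmulE x y m : cmul x y m = cmul_formula x y m :> F.
Proof.
rewrite cmul_coord.
have R k : \sum_l (x k : F) * (y l : F) * (cbasis_mul k l m : F) =
   (x k : F) * \sum_l (y l : F) * (zcoef k l m)%:~R.
  by rewrite mulr_sumr; apply: eq_bigr => l _; rewrite zcoefE mulrA.
under eq_bigr do rewrite R.
rewrite sum_cidx8.
have R2 k : \sum_l (y l : F) * (zcoef k l m)%:~R =
  (y IE1 : F) * (zcoef k IE1 m)%:~R + (y IE2 : F) * (zcoef k IE2 m)%:~R +
  ((y (IU 0) : F) * (zcoef k (IU 0) m)%:~R + (y (IU 1) : F) * (zcoef k (IU 1) m)%:~R + (y (IU 2) : F) * (zcoef k (IU 2) m)%:~R)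
  +  ((y (IV 0) : F) * (zcoef k (IV 0) m)%:~R + (y (IV 1) : F) * (zcoef k (IV 1) m)%:~R + (y (IV 2) : F) * (zcoef k (IV 2) m)%:~R).
  by rewrite sum_cidx8.
rewrite !{}R2.
rewrite /cmul_formula.
have z1 : 1 + 1 = 2 :> 'Z_3 by apply: val_inj.
have z2 : 1 + 2 = 0 :> 'Z_3 by apply: val_inj.
have z3 : 2 + 1 = 0 :> 'Z_3 by apply: val_inj.
have z4 : 2 + 2 = 1 :> 'Z_3 by apply: val_inj.
have zE := (z1, z2, z3, z4, add0r (1 : 'Z_3), add0r (2 : 'Z_3)).
case: m {R} => [||i|i]; try (elim/Z3P: i); rewrite ?sum_Z3 ?zE.
all: rewrite /zcoef /=.
all: ring.
Qed.
Lemma cpolarE x y : cpolar x y =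
  (x IE1 : F) * y IE2 + (x IE2 : F) * y IE1
  + \sum_i ((x (IU i) : F) * y (IV i) + (x (IV i) : F) * y (IU i)).
Proof. by rewrite /cpolar /cnorm !sum_Z3 !ffunE; ring. Qed.

Lemma coneE k : cone k = match k with IE1 | IE2 => 1 | _ => 0 end :> F.
Proof.
by case: k => [||i|i]; rewrite !ffunE; [exact: addr0|exact: add0r|exact: addr0|exact: addr0].
Qed.

Lemma cpolar_cone x : cpolar x cone = (x IE1 : F) + x IE2.
Proof. by rewrite cpolarE sum_Z3 !coneE; ring. Qed.

Lemma cconjE x k : cconj x k =
  match k with IE1 => x IE2 | IE2 => x IE1 | l => - x l end :> F.
Proof.
rewrite /cconj cpolar_cone.
transitivity (((x IE1 : F) + x IE2) * (cone k : F) - x k); first by rewrite !ffunE.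
by rewrite coneE; case: k => [||i|i]; ring.
Qed.

Lemma cconjK : involutive cconj.
Proof. by move=> x; apply/ffunP; case=> [||i|i]; rewrite !cconjE ?opprK. Qed.

Lemma cconjM x y : cconj (cmul x y) = cmul (cconj y) (cconj x).
Proof.
apply/ffunP => k; rewrite cconjE [RHS]cmulE.
by case: k => [||i|i]; rewrite !cmulE /cmul_formula ?sum_Z3 !cconjE; ring.
Qed.

Lemma cmul_conj_sym x y :
  cmul x (cconj y) + cmul y (cconj x) = cpolar x y *: cone.
Proof.
apply/ffunP => k.
transitivity ((cmul x (cconj y) k : F) + cmul y (cconj x) k); first by rewrite ffunE.
transitivity (cpolar x y * (cone k : F)); last by rewrite [RHS]ffunE.
rewrite !cmulE coneE cpolarE /cmul_formula.
by case: k => [||i|i]; rewrite ?sum_Z3 !cconjE; ring.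
Qed.

Fact cpolar_cone_linear : linear (fun x => cpolar x cone : F^o).
Proof.
move=> a x y; rewrite !cpolar_cone !ffunE.
by rewrite /GRing.scale /=; ring.
Qed.

Fact cconj_linear : linear cconj.
Proof.
have L a x y k : (a *: x + y : cay) k = a * (x k : F) + y k :> F.
  by rewrite !ffunE.
move=> a x y; apply/ffunP => k; rewrite cconjE [RHS]L !cconjE.
by case: k => [||i|i]; rewrite L //; ring.
Qed.
HB.instance Definition _ := GRing.isLinear.Build F cay cay *:%R cconj cconj_linear.

Definition ctrace (x : cay) : F^o := cpolar x cone.
HB.instance Definition _ := GRing.isLinear.Build F cay F^o *:%R ctrace cpolar_cone_linear.
Definition cay0 : {vspace cay} := lker (linfun ctrace).

Definition w1 : cay := cay_e1 - cay_e2.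
Definition w2 : cay := cay_u 1 - cay_v 1.
Definition w3 : cay := cay_u 2 - cay_v 2.

Definition w_pow (w : cay) (d : 'Z_2) : cay := if d == 0 then cone else w.

Definition cay_mon (d : 'rV['Z_2]_3) : cay :=
  cmul (cmul (w_pow w1 (d 0 0)) (w_pow w2 (d 0 1))) (w_pow w3 (d 0 2)).

(* the homogeneous component of degree d, where deg w_i = c_i *)
Definition cay_comp (d : 'rV['Z_2]_3) : {vspace cay} := <[cay_mon d]>%VS.

End Cayley.

Arguments cay_e1 {F}.
Arguments cay_e2 {F}.
Arguments cay_u {F} i.
Arguments cay_v {F} i.
Arguments cone {F}.

Section Albert.
Variable F : fieldType.
Local Notation cay := (cay F).

(* the parameters (alpha_1, alpha_2, alpha_3), (a_1, a_2, a_3); see [hmx] *)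
Definition albert := ({ffun 'Z_3 -> F^o} * {ffun 'Z_3 -> cay})%type.
HB.instance Definition _ := Vector.on albert.

(* a_k is the entry (k + 2, k + 1) and its conjugate the entry (k + 1, k + 2) *)
Definition hmx (X : albert) : 'M[cay]_3 :=
  \matrix_(i, j) (fun i j : 'Z_3 =>
    if i == j then (X.1 i : F) *: cone
    else if j == i + 1 then cconj (X.2 (i + 2)) else X.2 (i + 1)) i j.

Definition mxcmul (M N : 'M[cay]_3) : 'M[cay]_3 :=
  \matrix_(i, j) \sum_k cmul (M i k) (N k j).

Definition mxjordan (M N : 'M[cay]_3) : 'M[cay]_3 :=
  map_mx (fun x : cay => (2^-1 : F) *: x) (mxcmul M N + mxcmul N M).

(* the parameters of a Hermitian matrix; the scalars c 1 in the diagonal are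
   recovered as their coordinate in e_1 *)
Definition albert_of_mx (M : 'M[cay]_3) : albert :=
  ([ffun i : 'Z_3 => M i i IE1], [ffun k : 'Z_3 => M (k + 2) (k + 1)]).

Definition amul (X Y : albert) : albert := albert_of_mx (mxjordan (hmx X) (hmx Y)).

Lemma hmxK : cancel hmx albert_of_mx.
Proof.
case=> d a; congr (_, _); apply/ffunP => i; rewrite ffunE mxE.
  by rewrite eqxx ffunE coneE; exact: mulr1.
by elim/Z3P: i => /=; congr (a _); apply: val_inj.
Qed.

Lemma hmx_conj X i j : cconj (hmx X i j) = hmx X j i.
Proof.
have cc : cconj cone = cone :> cay.
  by apply/ffunP; case=> [||k|k]; rewrite cconjE !coneE ?oppr0.
rewrite !mxE; elim/Z3P: i; elim/Z3P: j => /=; rewrite ?linearZ /= ?cc ?cconjK //;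
  do ?congr (cconj _); congr (X.2 _); exact: val_inj.
Qed.

Lemma albert_of_mxK (M : 'M[cay]_3) :
    (forall i j, cconj (M i j) = M j i) ->
    (forall i, exists c : F, M i i = c *: cone) ->
  hmx (albert_of_mx M) = M.
Proof.
move=> Mconj Mdiag.
have D i : (M i i IE1 : F) *: cone = M i i.
  by have [c ->] := Mdiag i; rewrite ffunE coneE; congr (_ *: _); exact: mulr1.
apply/matrixP => i j; rewrite mxE.
elim/Z3P: i; elim/Z3P: j => /=; rewrite ffunE ?D // ?Mconj;
  congr (M _ _); exact: val_inj.
Qed.

(* Hermitian matrices are closed under the Jordan product *)
Lemma amulE X Y : hmx (amul X Y) = mxjordan (hmx X) (hmx Y).
Proof.
have SE i j : mxjordan (hmx X) (hmx Y) i j = 2^-1 *: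
    \sum_k (cmul (hmx X i k) (hmx Y k j) + cmul (hmx Y i k) (hmx X k j)).
  by rewrite !mxE big_split.
apply: albert_of_mxK => [i j|i]; rewrite !SE.
  rewrite linearZ linear_sum; congr (_ *: _); apply: eq_bigr => k _.
  by rewrite linearD /= !cconjM !hmx_conj addrC.
exists (2^-1 * \sum_k cpolar (hmx X i k) (hmx Y i k)).
rewrite -scalerA scaler_suml; congr (_ *: _); apply: eq_bigr => k _.
by rewrite -cmul_conj_sym !hmx_conj.
Qed.

Definition alb_E (i : 'Z_3) : albert := ([ffun j => (j == i)%:R], 0).
Definition alb_iota (i : 'Z_3) (a : cay) : albert :=
  (0, [ffun j => if j == i then 2 *: a else 0]).

Fact alb_iota_linear i : linear (alb_iota i).
Proof.
move=> c a b; congr (_, _); first by rewrite /= scaler0 addr0.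
apply/ffunP => j; rewrite !ffunE; case: eqP => _; last by rewrite scaler0 addr0.
by rewrite scalerDr !scalerA mulrC.
Qed.
HB.instance Definition _ i :=
  GRing.isLinear.Build F cay albert *:%R (alb_iota i) (alb_iota_linear i).

(* to be instantiated with a square root of -1 *)
Variable im : F.

Definition alb_E1 : albert := alb_E 1.
Definition alb_Etilde : albert := alb_E 2 + alb_E 3.
Definition nu (a : cay) : albert := im *: alb_iota 1 a.
(* nu_+ and nu_- are [nu_pm 1] and [nu_pm (-1)], and similarly for S^+, S^- *)
Definition nu_pm (s : F) (x : cay) : albert :=
  alb_iota 2 x + (s * im) *: alb_iota 3 (cconj x).
Definition S_pm (s : F) : albert :=
  alb_E 3 - alb_E 2 + (s * (im / 2)) *: alb_iota 1 cone.

Fact nu_linear : linear nu.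
Proof. by move=> c a b; rewrite /nu linearP scalerDr !scalerA mulrC. Qed.
HB.instance Definition _ := GRing.isLinear.Build F cay albert *:%R nu nu_linear.

Fact nu_pm_linear s : linear (nu_pm s).
Proof.
move=> c a b; rewrite /nu_pm (cconj_linear c a b) !(alb_iota_linear _ c).
move: (alb_iota 2 a) (alb_iota 2 b) (alb_iota 3 _) (alb_iota 3 _) => p q p' q'.
by rewrite scalerDr addrACA scalerDr !scalerA (mulrC c).
Qed.
HB.instance Definition _ s :=
  GRing.isLinear.Build F cay albert *:%R (nu_pm s) (nu_pm_linear s).

Definition Gamma (g : int * 'rV['Z_2]_3) : {vspace albert} :=
  let: (n, d) := g in
  if n == 0 then
    ((if (d == 0)%R then <[alb_E1]> + <[alb_Etilde]> else 0)
     + linfun nu @: (cay_comp F d :&: cay0 F))%VS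
  else if n == 1 then (linfun (nu_pm 1) @: cay_comp F d)%VS
  else if n == -1 then (linfun (nu_pm (-1)) @: cay_comp F d)%VS
  else if (n == 2) && (d == 0) then <[S_pm 1]>%VS
  else if (n == -2) && (d == 0) then <[S_pm (-1)]>%VS
  else 0%VS.

End Albert.

(* Main.v *)
Require Import Defs.
From HB Require Import structures.
From mathcomp Require Import all_boot all_order all_algebra.
From mathcomp Require Import boolp ring.

Set Implicit Arguments.
Unset Strict Implicit.
Unset Printing Implicit Defensive.

Import GRing.Theory.
Local Open Scope ring_scope.

(** An automorphism of Z x Z_2^3 has the form (n, d) |-> (s n, A d + n a) with
   s = 1 or -1, A an automorphism of Z_2^3 and a in Z_2^3. There are two things
   to show: that an automorphism of the algebra permuting the components acts on
   the degrees by such a map, and that all these maps occur.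

   For the first, let p be the permutation of the degrees induced by f. If the
   product of the components of degrees g and h is nonzero, then
   p (g + h) = p g + p h ([degree_permutation_add]), because the decomposition is
   a grading ([Gamma_mul]) and a nonzero element has at most one degree
   ([Gamma_degree]). The grading property is read off from a multiplication
   table. The uniqueness of degrees comes from the trace form: the trace vanishes
   on the components of nonzero degree, while every nonzero element of degree g
   has a partner of degree -g with which its product has nonzero trace
   ([Gamma_pairing]). Sufficiently many products are nonzero to conclude that p
   is the restriction of n p(1, 0) + p(0, d), which is additive
   ([degree_morphism]); the inverse of f makes it bijective.

   For the second, three linear isometries f_i of the octonions with
   f_(i+2) (x^ y^) = (f_i x)^ (f_(i+1) y)^, where x^ is the conjugate, define an
   automorphism of the Albert algebra which fixes the diagonal idempotents and
   applies f_i to the i-th off-diagonal entry ([alb_map_aut]). Three kinds of such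
   triples generate everything:
   - signs, which realize n |-> -n ([realizable_flip]);
   - one-sided and two-sided multiplications by a homogeneous imaginary octonion
     c of norm 1 and degree a, related by the Moufang identities, which realize
     d |-> d + n a ([realizable_translation]);
   - three copies of one automorphism of the octonions permuting the components
     of the Z_2^3-grading according to A ([realizable_lin]).
   To find the last automorphism, rescale the monomials in the w_i to a basis
   (e_d) with e_d e_d' = (-1)^sigma(d, d') e_(d+d') in which all elements but
   e_0 = 1 have square -1. Whether e_d and e_d' commute, and whether
   e_d, e_d', e_d'' associate, depends only on linear independence over Z_2, so
   these signs are the same for the transported basis e_(A d). Hence the quotient
   of the two multiplication signs is a symmetric 2-cocycle which is trivial on
   the diagonal, and such a cocycle is the coboundary of a sign eps; the
   automorphism is e_d |-> eps(d) e_(A d). *)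

(** * The Cayley algebra as a composition algebra *)

Fact Z3E :
  ((1 + 1 = 2 :> 'Z_3)%R * (1 + 2 = 0 :> 'Z_3)%R * (2 + 1 = 0 :> 'Z_3)%R
   * (2 + 2 = 1 :> 'Z_3)%R * (0 + 1 = 1 :> 'Z_3)%R * (0 + 2 = 2 :> 'Z_3)%R)%type.
Proof. by do !split; apply: val_inj. Qed.

Section Composition.
Variable F : fieldType.
Implicit Types (x y z c : cay F) (a : F).

Lemma cayD x y k : (x + y) k = (x k : F) + y k :> F.
Proof. by rewrite ffunE. Qed.

Lemma cayZ a x k : (a *: x) k = a * (x k : F) :> F.
Proof. by rewrite ffunE. Qed.

Lemma cayN x k : (- x) k = - (x k : F) :> F.
Proof. by rewrite ffunE. Qed.

Lemma cay_zeroE k : (0 : cay F) k = 0 :> F.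
Proof. by rewrite ffunE. Qed.

Fact cmul_linear x : linear (cmul x).
Proof.
move=> a y z; apply/ffunP => k; rewrite [RHS]cayD cayZ !cmulE.
by case: k => [||i|i]; rewrite /= ?sum_Z3 !(cayD, cayZ); ring.
Qed.
HB.instance Definition _ x :=
  GRing.isLinear.Build F (cay F) (cay F) *:%R (cmul x) (cmul_linear x).

Definition cmulr y x := cmul x y.

Fact cmulr_linear y : linear (cmulr y).
Proof.
move=> a x z; apply/ffunP => k; rewrite [RHS]cayD cayZ !cmulE.
by case: k => [||i|i]; rewrite /= ?sum_Z3 !(cayD, cayZ); ring.
Qed.
HB.instance Definition _ y :=
  GRing.isLinear.Build F (cay F) (cay F) *:%R (cmulr y) (cmulr_linear y).

Lemma cmulZl a x y : cmul (a *: x) y = a *: cmul x y.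
Proof. exact: (linearZ_LR (cmulr y)). Qed.

Lemma cmulZr a x y : cmul x (a *: y) = a *: cmul x y.
Proof. exact: (linearZ_LR (cmul x)). Qed.

Lemma cmulNr x y : cmul x (- y) = - cmul x y.
Proof. exact: (linearN (cmul x)). Qed.

Lemma cmulNl x y : cmul (- x) y = - cmul x y.
Proof. exact: (linearN (cmulr y)). Qed.

Lemma cmulDl x y z : cmul (x + y) z = cmul x z + cmul y z.
Proof. exact: (linearD (cmulr z)). Qed.

Lemma cmulDr x y z : cmul x (y + z) = cmul x y + cmul x z.
Proof. exact: (linearD (cmul x)). Qed.

Lemma cmul1x x : cmul cone x = x.
Proof.
apply/ffunP => k; rewrite cmulE.
by case: k => [||i|i]; rewrite /= ?sum_Z3 !coneE; ring.
Qed.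

Lemma cmulx1 x : cmul x cone = x.
Proof.
apply/ffunP => k; rewrite cmulE.
by case: k => [||i|i]; rewrite /= ?sum_Z3 !coneE; ring.
Qed.

Lemma cconj1 : cconj cone = cone :> cay F.
Proof. by apply/ffunP; case=> [||k|k]; rewrite cconjE !coneE ?oppr0. Qed.

Lemma cconjZ a x : cconj (a *: x) = a *: cconj x.
Proof. exact: (linearZ_LR (@cconj F)). Qed.

Lemma cpolarC x y : cpolar x y = cpolar y x.
Proof. by rewrite !cpolarE !sum_Z3; ring. Qed.

Fact cpolar_linear x : linear (cpolar x : cay F -> F^o).
Proof.
by move=> a y z; rewrite /GRing.scale /= !cpolarE !sum_Z3 !(cayD, cayZ); ring.
Qed.
HB.instance Definition _ x :=
  GRing.isLinear.Build F (cay F) F^o *:%R (cpolar x) (cpolar_linear x).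

Lemma cpolarZr a x y : cpolar x (a *: y) = a * cpolar x y.
Proof. exact: (linearZ_LR (cpolar x)). Qed.

Lemma cpolarZl a x y : cpolar (a *: x) y = a * cpolar x y.
Proof. by rewrite cpolarC cpolarZr cpolarC. Qed.

Lemma cpolarNr x y : cpolar x (- y) = - cpolar x y.
Proof. exact: (linearN (cpolar x)). Qed.

Lemma cpolarNl x y : cpolar (- x) y = - cpolar x y.
Proof. by rewrite cpolarC cpolarNr cpolarC. Qed.

Lemma cmul0x x : cmul 0 x = 0.
Proof. exact: (linear0 (cmulr x)). Qed.

Lemma cmulx0 x : cmul x 0 = 0.
Proof. exact: (linear0 (cmul x)). Qed.

Lemma cconj0 : cconj 0 = 0 :> cay F.
Proof. exact: (linear0 (@cconj F)). Qed.

Lemma cconjN x : cconj (- x) = - cconj x.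
Proof. exact: (linearN (@cconj F)). Qed.

Lemma cpolarx0 x : cpolar x 0 = 0.
Proof. by rewrite -[X in cpolar _ X](scale0r (0 : cay F)) cpolarZr mul0r. Qed.

Lemma cpolar0x x : cpolar 0 x = 0.
Proof. by rewrite cpolarC cpolarx0. Qed.

Lemma cpolar_conj x y : cpolar (cconj x) (cconj y) = cpolar x y.
Proof. by rewrite !cpolarE !sum_Z3 !cconjE; ring. Qed.

Lemma cpolarxx x : cpolar x x = 2 * cnorm x.
Proof. by rewrite cpolarE /cnorm !sum_Z3; ring. Qed.

(** Pairing with the basis vectors reads off all the coordinates. *)
Lemma cpolar_inj x y : (forall z, cpolar x z = cpolar y z) -> x = y.
Proof.
move=> E; apply/ffunP => k.
pose k' := match k with IE1 => IE2 | IE2 => IE1 | IU i => IV i | IV i => IU i end.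
have P z : cpolar z (cbasis F k') = z k :> F.
  rewrite cpolarE sum_Z3 !ffunE /k'.
  by case: k {k'} => [||i|i] /=; try (elim/Z3P: i => /=); ring.
by rewrite -!P E.
Qed.

Lemma cpolar_mull x y z : cpolar (cmul x y) z = cpolar y (cmul (cconj x) z).
Proof. by rewrite !cpolarE !sum_Z3 !cmulE /= !sum_Z3 !Z3E !cconjE; ring. Qed.

Lemma cpolar_mulr x y z : cpolar (cmul x y) z = cpolar x (cmul z (cconj y)).
Proof. by rewrite !cpolarE !sum_Z3 !cmulE /= !sum_Z3 !Z3E !cconjE; ring. Qed.

(** The norm is multiplicative; this is n(x y) = n(x) n(y) linearized in both
   factors, the form from which the Moufang identities are obtained. *)
Lemma cpolar_cross x y z w :
  cpolar (cmul x y) (cmul z w) + cpolar (cmul x w) (cmul z y)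
  = cpolar x z * cpolar y w.
Proof. by rewrite !cpolarE !sum_Z3 !cmulE /= !sum_Z3 !Z3E; ring. Qed.

Lemma cconj_mulK x y : cmul (cconj x) (cmul x y) = cnorm x *: y.
Proof.
apply/ffunP => k; rewrite [RHS]cayZ cmulE /cnorm.
case: k => [||i|i]; try (elim/Z3P: i).
all: by rewrite /= ?sum_Z3 ?Z3E !cmulE /= ?sum_Z3 ?Z3E !cconjE; ring.
Qed.
End Composition.

Section Moufang.
Variable F : fieldType.
Implicit Types (x y z a c : cay F).

Lemma cmul_conjK x y : cmul (cmul x (cconj y)) y = cnorm y *: x.
Proof.
apply: (can_inj (@cconjK F)).
by rewrite !cconjM cconjK cconj_mulK linearZ.
Qed.

Lemma cmul_conj_id x : cmul (cconj x) x = cnorm x *: cone.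
Proof. by rewrite -{2}[x]cmulx1 cconj_mulK. Qed.

(** Paired with any z, both sides become
   n(x y, a^) n(a, z) - n(a) n(x y, z^) by [cpolar_cross], ^ being conjugation. *)
Lemma moufang_mid a x y :
  cmul (cmul a x) (cmul y a) = cmul a (cmul (cmul x y) a).
Proof.
apply: cpolar_inj => z; rewrite !(cpolar_mull a) cpolar_mull cconjM.
have := cpolar_cross y a (cmul (cconj x) (cconj a)) z.
rewrite cmul_conjK cpolarZr (cpolar_mulr y z) => /(canRL (addrK _)) ->.
have := cpolar_cross (cmul x y) a (cconj a) z.
rewrite cmul_conj_id cpolarZr (cpolar_mulr _ z) cmul1x => /(canRL (addrK _)) ->.
by rewrite !(cpolar_mull x).
Qed.

(** As for [moufang_mid], both sides pair with z to
   n(x, a^) n(a y, z) - n(a) n(x z, y). *)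
Lemma moufang_left a x y :
  cmul a (cmul x (cmul a y)) = cmul (cmul a (cmul x a)) y.
Proof.
apply: cpolar_inj => z; rewrite (cpolar_mulr _ y) !(cpolar_mull a).
have := cpolar_cross x (cmul a y) (cconj a) z.
rewrite cconj_mulK cpolarZr (cpolar_mull x z) => /(canRL (addrK _)) ->.
have := cpolar_cross x a (cconj a) (cmul z (cconj y)).
rewrite cmul_conj_id cpolarZr (cpolar_mull x _ cone) cmulx1.
rewrite (cpolar_mulr z) cconjK => /(canRL (addrK _)) ->.
by rewrite (cpolar_mulr a).
Qed.

Lemma cmul_flex a x : cmul a (cmul x a) = cmul (cmul a x) a.
Proof. by have := moufang_mid a x cone; rewrite cmul1x cmulx1. Qed.

Lemma moufang_right a x y :
  cmul x (cmul a (cmul y a)) = cmul (cmul (cmul x a) y) a.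
Proof.
apply: (can_inj (@cconjK F)).
by rewrite !cconjM moufang_left cmul_flex.
Qed.

End Moufang.

(** * A basis of the Cayley algebra indexed by the group *)

Section Bits.
Implicit Types d e : 'rV['Z_2]_3.

Definition bit d (i : 'I_3) : bool := d 0 i != 0.

Lemma bitD d e i : bit (d + e) i = bit d i (+) bit e i.
Proof.
by rewrite /bit mxE; case: (d 0 i) => [[|[|//]] ?]; case: (e 0 i) => [[|[|//]] ?].
Qed.

Lemma bit0 i : bit 0 i = false.
Proof. by rewrite /bit mxE. Qed.

Lemma bit_inj d e : bit d =1 bit e -> d = e.
Proof.
move=> E; apply/rowP => i; have := E i; rewrite /bit.
by case: (d 0 i) => [[|[|//]] ?]; case: (e 0 i) => [[|[|//]] ?] // _; apply: val_inj.
Qed.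

Definition of_bits b0 b1 b2 : 'rV['Z_2]_3 :=
  \row_i (nth false [:: b0; b1; b2] i)%:R.

Lemma bit_of_bits b0 b1 b2 :
  (bit (of_bits b0 b1 b2) 0 = b0) * (bit (of_bits b0 b1 b2) 1 = b1)
  * (bit (of_bits b0 b1 b2) 2 = b2).
Proof. by rewrite /bit !mxE /=; case: b0 b1 b2 => [] [] []. Qed.

Lemma bit_eq d e :
  (d == e) = [&& bit d 0 == bit e 0, bit d 1 == bit e 1 & bit d 2 == bit e 2].
Proof.
apply/eqP/and3P => [-> //|[/eqP E0 /eqP E1 /eqP E2]].
by apply: bit_inj; elim/Z3P.
Qed.

Lemma of_bitsK d : of_bits (bit d 0) (bit d 1) (bit d 2) = d.
Proof. by apply/eqP; rewrite bit_eq !bit_of_bits !eqxx. Qed.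

Lemma row2_addrr d : d + d = 0.
Proof. by apply/eqP; rewrite bit_eq !bitD !addbb !bit0. Qed.

Lemma row2_oppr d : - d = d.
Proof. by apply/esym/eqP; rewrite -addr_eq0 row2_addrr. Qed.

(** The exponent of the sign in the product of two basis octonions of degrees x
   and y, as a polynomial over Z_2. The cubic terms are the ones that break
   associativity: without them the sign would be bilinear in x and y. *)
Definition osgn (x0 x1 x2 y0 y1 y2 : bool) : bool :=
  (x0 && y0) (+) (x1 && (y0 (+) y1)) (+) (x2 && (y0 (+) y1 (+) y2))
  (+) (x0 && y1 && y2) (+) (y0 && x1 && y2) (+) (y0 && y1 && x2).

Definition sigma d e : bool :=
  osgn (bit d 0) (bit d 1) (bit d 2) (bit e 0) (bit e 1) (bit e 2).
End Bits.

(** The factors im turn the generators w_i, of square 1, into elements of square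
   -1; the resulting basis is orthogonal and all its elements have norm 1. *)
HB.lock Definition oct (F : fieldType) (im : F) (d : 'rV['Z_2]_3) : cay F :=
  im ^+ (bit d 0 + bit d 1 + bit d 2) *: cay_mon F d.

Section OctonionBasis.
Variables (F : fieldType) (im : F).
Hypotheses (him : im ^+ 2 = -1).
Implicit Types d e : 'rV['Z_2]_3.

Local Notation oct := (oct im).

(** The coordinates of the basis vectors, in terms of the bits of their degree. *)
Definition octc (b0 b1 b2 : bool) (k : cidx) : F :=
  match b0, b1, b2, k with
  | false, false, false, (IE1 | IE2) => 1
  | true, false, false, IE1 => im
  | true, false, false, IE2 => - im
  | false, true, false, IU i => if i == 1 then im else 0
  | false, true, false, IV i => if i == 1 then - im else 0
  | false, false, true, IU i => if i == 2 then im else 0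
  | false, false, true, IV i => if i == 2 then - im else 0
  | true, true, false, (IU i | IV i) => if i == 1 then - 1 else 0
  | true, false, true, (IU i | IV i) => if i == 2 then - 1 else 0
  | false, true, true, (IU i | IV i) => if i == 0 then - 1 else 0
  | true, true, true, IU i => if i == 0 then im else 0
  | true, true, true, IV i => if i == 0 then - im else 0
  | _, _, _, _ => 0
  end.

(** The coordinates of a u_l + b v_l. *)
Let uv (l : 'Z_3) (a b : F) (k : cidx) : F :=
  match k with IU i => if i == l then a else 0
             | IV i => if i == l then b else 0 | _ => 0 end.

Lemma oct_coord d k : oct d k = octc (bit d 0) (bit d 1) (bit d 2) k :> F.
Proof.
have w1E j : w1 F j = match j with IE1 => 1 | IE2 => -1 | _ => 0 end :> F.
  by rewrite cayD cayN !ffunE; case: j => *; rewrite /= ?subr0 ?sub0r ?oppr0.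
have uvE l j : (cay_u l - cay_v l) j = uv l 1 (-1) j :> F.
  have UE k' : (IU k' == IU l) = (k' == l) by apply/eqP/eqP => [[->]|->].
  have VE k' : (IV k' == IV l) = (k' == l) by apply/eqP/eqP => [[->]|->].
  rewrite cayD cayN !ffunE; case: j => [||k'|k']; rewrite /= ?UE ?VE;
    by rewrite /uv; try case: (k' == l); rewrite /=; ring.
have w2E j : w2 F j = uv 1 1 (-1) j :> F := uvE 1 j.
have w3E j : w3 F j = uv 2 1 (-1) j :> F := uvE 2 j.
rewrite oct.unlock cayZ /cay_mon.
move: (w1 F) (w2 F) (w3 F) w1E w2E w3E => p q r pE qE rE.
have pqE j : cmul p q j = uv 1 1 1 j :> F.
  rewrite cmulE; case: j => [||k'|k']; try (elim/Z3P: k');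
    by rewrite /= ?sum_Z3 ?Z3E ?pE ?qE ?rE /uv /=; ring.
have prE j : cmul p r j = uv 2 1 1 j :> F.
  rewrite cmulE; case: j => [||k'|k']; try (elim/Z3P: k');
    by rewrite /= ?sum_Z3 ?Z3E ?pE ?qE ?rE /uv /=; ring.
have qrE j : cmul q r j = uv 0 1 1 j :> F.
  rewrite cmulE; case: j => [||k'|k']; try (elim/Z3P: k');
    by rewrite /= ?sum_Z3 ?Z3E !qE !rE /uv /=; ring.
have pqrE j : cmul (cmul p q) r j = uv 0 (-1) 1 j :> F.
  rewrite cmulE; case: j => [||k'|k']; try (elim/Z3P: k');
    by rewrite /= ?sum_Z3 ?Z3E !pqE !rE /uv /=; ring.
have wE w (i : 'I_3) : w_pow w (d 0 i) = if bit d i then w else cone.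
  by rewrite /w_pow /bit; case: eqP.
rewrite !wE.
case: (bit d 0) (bit d 1) (bit d 2) => [] [] [].
all: rewrite ?(cmul1x, cmulx1) ?(pqrE, pqE, prE, qrE, pE, qE, rE, coneE).
all: case: k => [||k|k]; rewrite /= /uv; try case: eqP => _; ring: him.
Qed.

Lemma oct_mul d e : cmul (oct d) (oct e) = (-1) ^+ (sigma d e) *: oct (d + e).
Proof.
apply/ffunP => k; rewrite [RHS]cayZ oct_coord !bitD /sigma cmulE.
case: k => [||i|i]; try (elim/Z3P: i); rewrite /= ?sum_Z3 ?Z3E !oct_coord.
all: case: (bit d 0) (bit d 1) (bit d 2) => [] [] [].
all: case: (bit e 0) (bit e 1) (bit e 2) => [] [] [].
all: rewrite /= ; ring: him.
Qed.

Lemma oct_norm d : cnorm (oct d) = 1.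
Proof.
rewrite /cnorm sum_Z3 !oct_coord.
by case: (bit d 0) (bit d 1) (bit d 2) => [] [] [] /=; ring: him.
Qed.

Lemma oct_orth d e : d != e -> cpolar (oct d) (oct e) = 0.
Proof.
rewrite bit_eq cpolarE sum_Z3 !oct_coord.
case: (bit d 0) (bit d 1) (bit d 2) => [] [] [].
all: case: (bit e 0) (bit e 1) (bit e 2) => [] [] [] //= _; ring: him.
Qed.

Lemma oct0 : oct 0 = cone.
Proof.
by apply/ffunP => k; rewrite oct_coord coneE !bit0; case: k.
Qed.

Lemma oct_conj d : d != 0 -> cconj (oct d) = - oct d.
Proof. by move=> /oct_orth E; rewrite /cconj -oct0 E scale0r sub0r. Qed.

Lemma oct_conjE d : cconj (oct d) = (-1) ^+ (d != 0) *: oct d.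
Proof.
by have [->|d0] := eqVneq d 0;
  rewrite ?oct0 ?cconj1 ?scale1r // oct_conj // expr1 scaleN1r.
Qed.

Lemma im_neq0 : im != 0.
Proof.
apply/eqP => E; move/eqP: him.
by rewrite E expr0n /= eq_sym oppr_eq0 oner_eq0.
Qed.

Lemma cay_compE d : cay_comp F d = <[oct d]>%VS.
Proof.
apply/vspaceP => x; apply/vlineP/vlineP => -[a ->]; rewrite oct.unlock; last first.
  by rewrite scalerA; eexists.
exists (a / im ^+ (bit d 0 + bit d 1 + bit d 2)).
by rewrite scalerA divfK // expf_neq0 // im_neq0.
Qed.

Lemma oct_expand x : 2 *: x = \sum_d cpolar x (oct d) *: oct d.
Proof.
pose B := (bool * bool * bool)%type.
rewrite (reindex (fun b : B => of_bits b.1.1 b.1.2 b.2)) /=; last first.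
  exists (fun d => (bit d 0, bit d 1, bit d 2)) => [[[b0 b1] b2] _|d _] /=.
    by rewrite !bit_of_bits.
  exact: of_bitsK.
pose t b0 b1 b2 := cpolar x (oct (of_bits b0 b1 b2)) *: oct (of_bits b0 b1 b2).
rewrite -(pair_bigA _ (fun a b => t a.1 a.2 b)) /=.
rewrite -(pair_bigA _ (fun a a' => \sum_b t a a' b)) {}/t /=.
rewrite !big_bool /=; apply/ffunP => k; rewrite !(cayD, cayZ).
rewrite !cpolarE !sum_Z3 !oct_coord !bit_of_bits.
case: k => [||i|i]; try (elim/Z3P: i); rewrite /=; ring: him.
Qed.

Hypothesis two0 : (2 : F) != 0.

Lemma oct_linext (V : lmodType F) (g h : {linear cay F -> V}) :
  (forall d, g (oct d) = h (oct d)) -> g =1 h.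
Proof.
move=> E x; apply: (scalerI two0); rewrite -!linearZ /= oct_expand !linear_sum.
by apply: eq_bigr => d _; rewrite !linearZ /= E.
Qed.
End OctonionBasis.

(** * Lifting linear substitutions of the degrees to the Cayley algebra *)

Section SignCocycle.
Implicit Types d e f : 'rV['Z_2]_3.

Lemma sigma0d d : sigma 0 d = false.
Proof. by rewrite /sigma !bit0 /osgn /= !andbF. Qed.

Lemma sigma_sqr d : sigma d d = (d != 0).
Proof.
rewrite bit_eq !bit0 /sigma.
by case: (bit d 0) (bit d 1) (bit d 2) => [] [] [].
Qed.

(** Two basis octonions anticommute exactly when their degrees are linearly
   independent, a condition preserved by injective additive maps. *)
Lemma sigma_comm d e :
  sigma d e (+) sigma e d = [&& d != 0, e != 0 & d != e].
Proof.
rewrite !bit_eq !bit0 /sigma.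
case: (bit d 0) (bit d 1) (bit d 2) => [] [] [];
by case: (bit e 0) (bit e 1) (bit e 2) => [] [] [].
Qed.

(** Three basis octonions antiassociate exactly when their degrees are linearly
   independent. Over Z_2 this says that the three degrees are nonzero and
   distinct and that none is the sum of the other two. *)
Lemma sigma_assoc d e f :
  sigma d e (+) sigma (d + e) f (+) sigma e f (+) sigma d (e + f)
  = [&& d != 0, e != 0, f != 0, d != e, d != f, e != f & d + e != f].
Proof.
rewrite !bit_eq !bit0 /sigma !bitD.
case: (bit d 0) (bit d 1) (bit d 2) => [] [] [];
case: (bit e 0) (bit e 1) (bit e 2) => [] [] [];
by case: (bit f 0) (bit f 1) (bit f 2) => [] [] [].
Qed.

Lemma of_bitsD a0 a1 a2 b0 b1 b2 :
  of_bits a0 a1 a2 + of_bits b0 b1 b2 =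
  of_bits (a0 (+) b0) (a1 (+) b1) (a2 (+) b2).
Proof. by apply/eqP; rewrite bit_eq !bitD !bit_of_bits !eqxx. Qed.

Lemma of_bits0 : of_bits false false false = 0.
Proof. by apply/eqP; rewrite bit_eq !bit0 !bit_of_bits. Qed.

Section Coboundary.
Variable T : 'rV['Z_2]_3 -> 'rV['Z_2]_3 -> bool.
Hypotheses (T0 : forall d, T 0 d = false) (Tdd : forall d, T d d = false).
Hypothesis TC : forall d e, T d e = T e d.
Hypothesis TA : forall d e f, T d e (+) T (d + e) f = T e f (+) T d (e + f).

(** T describes a commutative and associative algebra with basis z_d and product
   z_d z_e = (-1)^T(d, e) z_(d+e). The identity compares the signs in
   (z_x z_x') (z_y z_y') = (z_x z_y) (z_x' z_y'). *)
Lemma cocycle_interchange x x' y y' :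
  T x x' (+) T y y' (+) T (x + x') (y + y')
  = T x y (+) T x' y' (+) T (x + y) (x' + y').
Proof.
have H u v : T x u (+) T v y' (+) T (x + u) (v + y')
           = T u v (+) T (u + v) y' (+) T x (u + v + y').
  have := TA x u (v + y'); have := TA u v y'; rewrite addrA.
  move: (T x u) (T (x + u) (v + y')) (T u (v + y')) (T x (u + v + y')).
  move: (T u v) (T v y') (T (u + v) y').
  by move=> [] [] [] [] [] [] [].
by rewrite !H (TC x' y) (addrC x').
Qed.

(** The sign of the product of the z_c, over the standard basis vectors c
   occurring in d, relative to z_d. *)
Definition cobound d : bool :=
  T (of_bits (bit d 0) false false) (of_bits false (bit d 1) false) (+)
  T (of_bits (bit d 0) (bit d 1) false) (of_bits false false (bit d 2)).

(** The products of subsets of three commuting elements z_c of square 1 multiply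
   without signs, since repeated factors cancel. *)
Lemma coboundP d e : cobound d (+) cobound e (+) T d e = cobound (d + e).
Proof.
have T00 a0 a1 a2 b :
    T (of_bits (a0 && b) (a1 && b) (a2 && b)) (of_bits a0 a1 a2) = false.
  by case: b; rewrite ?andbT ?Tdd // !andbF of_bits0 T0.
have Te (a0 a1 a2 x y : bool) : T (of_bits (a0 && x) (a1 && x) (a2 && x))
    (of_bits (a0 && y) (a1 && y) (a2 && y)) = false.
  case: y; first by rewrite !andbT T00.
  by rewrite !andbF of_bits0 TC T0.
have E := cocycle_interchange.
rewrite /cobound !bitD.
have := E (of_bits (bit d 0) (bit d 1) false) (of_bits false false (bit d 2))
          (of_bits (bit e 0) (bit e 1) false) (of_bits false false (bit e 2)).
have := E (of_bits (bit d 0) false false) (of_bits false (bit d 1) false)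
          (of_bits (bit e 0) false false) (of_bits false (bit e 1) false).
have := Te true false false (bit d 0) (bit e 0).
have := Te false true false (bit d 1) (bit e 1).
have := Te false false true (bit d 2) (bit e 2).
rewrite /= => -> -> ->.
rewrite !of_bitsD !addbF !addFb !of_bitsK /= => <-.
do 7 move: (T _ _).
by move=> [] [] [] [] [] [] [].
Qed.
End Coboundary.
End SignCocycle.

Section OctonionAutomorphism.
Variables (F : fieldType) (im : F).
Hypotheses (him : im ^+ 2 = -1) (two0 : (2 : F) != 0).
Variable A : 'rV['Z_2]_3 -> 'rV['Z_2]_3.
Hypotheses (AD : {morph A : d e / d + e}) (Ainj : injective A).
Local Notation oct := (oct im).

Let A0 : A 0 = 0.
Proof. by apply: (addrI (A 0)); rewrite -AD !addr0. Qed.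

Let AE d e : (A d == A e) = (d == e).
Proof. exact: inj_eq. Qed.

Let AE0 d : (A d == 0) = (d == 0).
Proof. by rewrite -{1}A0 AE. Qed.

(** The sign to be compensated: the basis transported by A multiplies with
   sigma (A d) (A e) in place of sigma d e. *)
Let tau d e := sigma (A d) (A e) (+) sigma d e.

Let tau0 d : tau 0 d = false.
Proof. by rewrite /tau A0 !sigma0d. Qed.
Let taudd d : tau d d = false.
Proof. by rewrite /tau !sigma_sqr AE0 addbb. Qed.
Let tauC d e : tau d e = tau e d.
Proof.
have := sigma_comm (A d) (A e); rewrite !AE0 AE -sigma_comm /tau.
by case: (sigma (A d) (A e)) (sigma (A e) (A d)) (sigma d e) (sigma e d)
  => [] [] [] [].
Qed.
Let tauA d e f : tau d e (+) tau (d + e) f = tau e f (+) tau d (e + f).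
Proof.
have := sigma_assoc (A d) (A e) (A f).
rewrite -!AD !AE0 !AE -sigma_assoc /tau.
move: (sigma (A d) (A e)) (sigma (A e) (A f)) (sigma (A (d + e)) (A f)).
move: (sigma (A d) (A (e + f))) (sigma d e) (sigma e f) (sigma (d + e) f).
by move: (sigma d (e + f)) => [] [] [] [] [] [] [] [].
Qed.

(** The coordinate of x on a basis octonion of norm 1 is half of its pairing with
   it. *)
Definition oct_lin (x : cay F) : cay F :=
  \sum_d ((-1) ^+ (cobound tau d) * (cpolar x (oct d) / 2)) *: oct (A d).

Fact oct_lin_linear : linear oct_lin.
Proof.
move=> a x y; rewrite /oct_lin scaler_sumr -big_split; apply: eq_bigr => d _ /=.
rewrite scalerA -scalerDl; congr (_ *: _).
have -> : cpolar (a *: x + y) (oct d) = a * cpolar x (oct d) + cpolar y (oct d).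
  by rewrite !(cpolarC _ (oct d)); exact: cpolar_linear.
by move: (_ ^+ _ : F) (cpolar x _) (cpolar y _) => s p q; ring.
Qed.
HB.instance Definition _ :=
  GRing.isLinear.Build F (cay F) (cay F) *:%R oct_lin oct_lin_linear.

Lemma oct_linE d : oct_lin (oct d) = (-1) ^+ (cobound tau d) *: oct (A d).
Proof.
rewrite /oct_lin (bigD1 d) //= big1 => [|e ned].
  by rewrite addr0 cpolarxx oct_norm // mulr1 divff // mulr1.
by rewrite cpolarC oct_orth // mul0r mulr0 scale0r.
Qed.

Lemma oct_lin1 : oct_lin cone = cone.
Proof.
rewrite -(oct0 him) oct_linE A0 /cobound !bit0.
by rewrite !of_bits0 tau0 scale1r.
Qed.

Lemma oct_linM x y : oct_lin (cmul x y) = cmul (oct_lin x) (oct_lin y).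
Proof.
apply: (oct_linext him two0 (g := oct_lin \o cmul x)
  (h := cmul (oct_lin x) \o oct_lin)).
move=> e /=; move: x.
apply: (oct_linext him two0 (g := oct_lin \o cmulr (oct e))
  (h := cmulr (oct_lin (oct e)) \o oct_lin)) => d /=.
rewrite /cmulr oct_mul // linearZ_LR /= !oct_linE cmulZl cmulZr oct_mul // AD.
rewrite !scalerA -!signr_addb; congr ((-1) ^+ (nat_of_bool _) *: _).
rewrite -coboundP // /tau.
move: (cobound _ d) (cobound _ e) (sigma d e) (sigma (A d) (A e)).
by move=> [] [] [] [].
Qed.

Lemma oct_lin_conj x : oct_lin (cconj x) = cconj (oct_lin x).
Proof.
apply: (oct_linext him two0 (g := oct_lin \o @cconj F)
  (h := @cconj F \o oct_lin)).
move=> d /=; have [->|d0] := eqVneq d 0.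
  by rewrite oct0 // cconj1 oct_lin1 cconj1.
by rewrite oct_conj // linearN /= oct_linE cconjZ oct_conj ?AE0 // scalerN.
Qed.

(** Conjugation and product determine the norm form:
   x y^ + y x^ = n(x, y) 1. *)
Lemma oct_lin_polar x y : cpolar (oct_lin x) (oct_lin y) = cpolar x y.
Proof.
have := congr1 oct_lin (cmul_conj_sym x y).
rewrite linearD linearZ /= !oct_linM !oct_lin_conj cmul_conj_sym oct_lin1.
by move=> /ffunP/(_ IE1); rewrite !cayZ !coneE !mulr1.
Qed.

End OctonionAutomorphism.

(** * The Albert algebra in coordinates, and automorphisms from related triples *)

Section AlbertCoordinates.
Variable F : fieldType.
Hypothesis two0 : (2 : F) != 0.
Implicit Types X Y : albert F.

Lemma amul_diag X Y i : (amul X Y).1 i = (X.1 i : F) * Y.1 i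
  + 2^-1 * (cpolar (X.2 (i + 1)) (Y.2 (i + 1)) + cpolar (X.2 (i + 2)) (Y.2 (i + 2))) :> F.
Proof.
have -> : (amul X Y).1 i = 2^-1 * \sum_k cpolar (hmx X i k) (hmx Y i k) :> F.
  rewrite /amul ffunE !mxE -big_split cayZ sum_ffunE; congr (_ * _).
  apply: eq_bigr => k _ /=.
  by rewrite -(hmx_conj Y i k) -(hmx_conj X i k) cmul_conj_sym cayZ coneE mulr1.
have cc (a b : F) : cpolar (a *: cone) (b *: cone) = 2 * (a * b).
  by rewrite cpolarZl cpolarZr cpolar_cone !coneE; ring.
rewrite sum_Z3 !mxE; elim/Z3P: i => /=.
all: rewrite ?Z3E /= ?cc ?cpolar_conj; by field.
Qed.

Lemma amul_off X Y k : (amul X Y).2 k = 2^-1 *: (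
    ((X.1 (k + 1) : F) + X.1 (k + 2)) *: Y.2 k + ((Y.1 (k + 1) : F) + Y.1 (k + 2)) *: X.2 k
    + cmul (cconj (X.2 (k + 1))) (cconj (Y.2 (k + 2)))
    + cmul (cconj (Y.2 (k + 1))) (cconj (X.2 (k + 2)))) :> cay F.
Proof.
rewrite /amul ffunE mxE; congr (_ *: _); rewrite !mxE -big_split /= sum_Z3 !mxE.
elim/Z3P: k => /=; rewrite ?Z3E /=.
all: rewrite ?cmulZl ?cmulZr ?cmul1x ?cmulx1.
all: apply/ffunP => j; rewrite !(cayD, cayZ); ring.
Qed.

Lemma amul_coord X Y : amul X Y =
  ([ffun i => (X.1 i : F) * Y.1 i + 2^-1 *
      (cpolar (X.2 (i + 1)) (Y.2 (i + 1)) + cpolar (X.2 (i + 2)) (Y.2 (i + 2)))],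
   [ffun k => 2^-1 *: (((X.1 (k + 1) : F) + X.1 (k + 2)) *: Y.2 k
      + ((Y.1 (k + 1) : F) + Y.1 (k + 2)) *: X.2 k
      + cmul (cconj (X.2 (k + 1))) (cconj (Y.2 (k + 2)))
      + cmul (cconj (Y.2 (k + 1))) (cconj (X.2 (k + 2))))]).
Proof.
rewrite [LHS]surjective_pairing.
congr (_, _); apply/ffunP => i; rewrite [RHS]ffunE.
  exact: amul_diag.
exact: amul_off.
Qed.

Lemma amulC X Y : amul X Y = amul Y X.
Proof.
rewrite !amul_coord; congr (_, _); apply/ffunP => i; rewrite !ffunE.
  by rewrite (mulrC (X.1 i : F)) !(cpolarC (X.2 _)).
by congr (_ *: _); rewrite -!addrA addrCA [X in _ + (_ + X)]addrC.
Qed.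

Fact amul_linear X : linear (amul X).
Proof.
move=> a Y Z.
have L i : (a *: Y + Z : albert F).2 i = a *: (Y.2 i) + Z.2 i by rewrite !ffunE.
have L1 i : (a *: Y + Z).1 i = a * (Y.1 i : F) + Z.1 i :> F.
  by rewrite !ffunE.
rewrite !amul_coord; congr (_, _); apply/ffunP => i.
  rewrite [LHS]ffunE !L !L1 !ffunE !(cpolar_linear _ a) /GRing.scale /=; ring.
rewrite [LHS]ffunE !L !L1 !cconj_linear !ffunE.
move: (cconj _) (cconj _) (cconj _) (cconj _) (cconj _) (cconj _) => x1 y2 z2 y1 z1 x2.
rewrite !(cmulDl, cmulDr, cmulZl, cmulZr).
move: (cmul _ _) (cmul _ _) (cmul _ _) (cmul _ _) => p q r s.
by apply/ffunP => j; rewrite !(cayD, cayZ); ring.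
Qed.
HB.instance Definition _ X :=
  GRing.isLinear.Build F (albert F) (albert F) *:%R (amul X) (amul_linear X).
End AlbertCoordinates.

Section RelatedTriple.
Variable F : fieldType.
Hypothesis two0 : (2 : F) != 0.
Variable f : 'Z_3 -> {linear cay F -> cay F}.

Definition alb_map (X : albert F) : albert F :=
  (X.1, [ffun i => f i (X.2 i)]).

Fact alb_map_linear : linear alb_map.
Proof.
move=> a X Y; congr (_, _); apply/ffunP => i; rewrite !ffunE.
by rewrite linearP.
Qed.
HB.instance Definition _ := GRing.isLinear.Build F (albert F) (albert F) *:%R
  alb_map alb_map_linear.

Hypothesis f_polar : forall i x y, cpolar (f i x) (f i y) = cpolar x y.
Hypothesis f_triple : forall i x y,
  f (i + 2) (cmul (cconj x) (cconj y)) = cmul (cconj (f i x)) (cconj (f (i + 1) y)).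

(** Off the diagonal the product of two vectors is built from the scalars on the
   diagonal and from (x, y) |-> x^ y^ between different slots; on the diagonal it
   only involves the norm form inside each slot. *)
Lemma alb_mapM X Y : alb_map (amul X Y) = amul (alb_map X) (alb_map Y).
Proof.
have T i x y : f i (cmul (cconj x) (cconj y)) =
    cmul (cconj (f (i + 1) x)) (cconj (f (i + 2) y)).
  have := f_triple (i + 1) x y; rewrite -!addrA.
  have -> : 1 + 1 = 2 :> 'Z_3 by apply: val_inj.
  by have -> : i + (1 + 2) = i by elim/Z3P: i; apply: val_inj.
rewrite !amul_coord // /alb_map /=; congr (_, _); apply/ffunP => i; rewrite !ffunE.
  by rewrite !f_polar.
by rewrite (linearZ_LR (f i)) !(linearD (f i)) !(linearZ_LR (f i)) !T.
Qed.

(** Isometries of a nondegenerate form are injective. *)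
Lemma alb_map_inj : injective alb_map.
Proof.
move=> [X1 X2] [Y1 Y2] [-> /ffunP E]; congr (_, _); apply/ffunP => i.
apply: cpolar_inj => z; rewrite -[LHS](f_polar i) -[RHS](f_polar i).
by have := E i; rewrite !ffunE /= => ->.
Qed.

Lemma alb_map_aut : exists g : algaut (@amul F), forall X, g X = alb_map X.
Proof.
have K : lker (linfun alb_map) == 0%VS.
  by apply/lker0P => X Y; rewrite !lfunE; apply: alb_map_inj.
have M : {morph linfun alb_map : X Y / amul X Y}.
  by move=> X Y; rewrite !lfunE; apply: alb_mapM.
by exists (AlgAut K M) => X; rewrite lfunE.
Qed.
End RelatedTriple.

(** * The multiplication table of the homogeneous elements *)

Definition sel3 (T : Type) (t0 t1 t2 : T) (i : 'Z_3) : T :=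
  if i == 0 then t0 else if i == 1 then t1 else t2.

(** Vectors are handled by their three scalars and three octonions, with indices
   modulo 3 in the order 0, 1, 2, so that the slots of E_3 and iota_3 come
   first. *)
HB.lock Definition albv (F : fieldType) (a0 a1 a2 : F) (x0 x1 x2 : cay F) : albert F :=
  ([ffun i => sel3 a0 a1 a2 i : F^o], [ffun i => sel3 x0 x1 x2 i]).

Section MultiplicationTable.
Variables (F : fieldType) (im : F).
Hypotheses (him : im ^+ 2 = -1) (two0 : (2 : F) != 0).
Implicit Types (a b c s : F) (x y z : cay F).

Lemma albvZ c a0 a1 a2 x0 x1 x2 : c *: albv a0 a1 a2 x0 x1 x2 =
  albv (c * a0) (c * a1) (c * a2) (c *: x0) (c *: x1) (c *: x2).
Proof.
by rewrite albv.unlock; congr (_, _); apply/ffunP; elim/Z3P; rewrite !ffunE.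
Qed.

Lemma albvD a0 a1 a2 x0 x1 x2 b0 b1 b2 y0 y1 y2 :
  albv a0 a1 a2 x0 x1 x2 + albv b0 b1 b2 y0 y1 y2 =
  albv (a0 + b0) (a1 + b1) (a2 + b2) (x0 + y0) (x1 + y1) (x2 + y2).
Proof.
by rewrite albv.unlock; congr (_, _); apply/ffunP; elim/Z3P; rewrite !ffunE.
Qed.

Lemma albv0 : 0 = albv 0 0 0 0 0 0 :> albert F.
Proof.
by rewrite albv.unlock; congr (_, _); apply/ffunP; elim/Z3P; rewrite !ffunE.
Qed.

Lemma amul_albv a0 a1 a2 x0 x1 x2 b0 b1 b2 y0 y1 y2 :
  amul (albv a0 a1 a2 x0 x1 x2) (albv b0 b1 b2 y0 y1 y2) =
  albv (a0 * b0 + 2^-1 * (cpolar x1 y1 + cpolar x2 y2))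
       (a1 * b1 + 2^-1 * (cpolar x2 y2 + cpolar x0 y0))
       (a2 * b2 + 2^-1 * (cpolar x0 y0 + cpolar x1 y1))
       (2^-1 *: ((a1 + a2) *: y0 + (b1 + b2) *: x0
          + cmul (cconj x1) (cconj y2) + cmul (cconj y1) (cconj x2)))
       (2^-1 *: ((a2 + a0) *: y1 + (b2 + b0) *: x1
          + cmul (cconj x2) (cconj y0) + cmul (cconj y2) (cconj x0)))
       (2^-1 *: ((a0 + a1) *: y2 + (b0 + b1) *: x2
          + cmul (cconj x0) (cconj y1) + cmul (cconj y0) (cconj x1))).
Proof.
rewrite amul_coord // albv.unlock /=.
by congr (_, _); apply/ffunP; elim/Z3P; rewrite !ffunE /= !Z3E.
Qed.

Lemma alb_E1E : alb_E1 F = albv 0 1 0 0 0 0.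
Proof.
by rewrite albv.unlock; congr (_, _); apply/ffunP; elim/Z3P; rewrite !ffunE.
Qed.

Lemma alb_EtildeE : alb_Etilde F = albv 1 0 1 0 0 0.
Proof.
rewrite albv.unlock; congr (_, _); apply/ffunP; elim/Z3P; rewrite !ffunE /=.
all: by rewrite ?addr0 ?add0r.
Qed.

Lemma nuE x : nu im x = albv 0 0 0 0 ((2 * im) *: x) 0.
Proof.
rewrite albv.unlock; congr (_, _); apply/ffunP; elim/Z3P; rewrite !ffunE /=.
all: by rewrite ?scaler0 ?scalerA // mulrC.
Qed.

Lemma nu_pmE s x : nu_pm im s x = albv 0 0 0 ((2 * s * im) *: cconj x) 0 (2 *: x).
Proof.
rewrite albv.unlock; congr (_, _); apply/ffunP; elim/Z3P; rewrite !ffunE /=.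
all: rewrite ?scaler0 ?addr0 ?add0r ?scalerA // -mulrA mulrC //.
Qed.

Lemma S_pmE s : S_pm im s = albv 1 0 (-1) 0 ((s * im) *: cone) 0.
Proof.
rewrite albv.unlock; congr (_, _); apply/ffunP; elim/Z3P; rewrite !ffunE /=.
all: rewrite ?scaler0 ?addr0 ?add0r ?subrr ?oppr0 ?subr0 ?addr0 // ?scalerA.
by rewrite add0r mulrA divfK.
Qed.

Let vecE := (alb_E1E, alb_EtildeE, nuE, nu_pmE, S_pmE).
Let zeroE := (cmul0x, cmulx0, cconj0, cpolarx0, cpolar0x).
Let addE := (mulr0, mul0r, mulr1, mul1r, addr0, add0r, scaler0, scale0r).
Let normE := (cmulZl, cmulZr, cconjZ, cpolarZl, cpolarZr, cconjK, cconj1, cmulx1, cmul1x).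

(** Both sides are linear combinations of products and conjugates of octonions,
   whose values do not matter for the identity. *)
Ltac octonion_combination :=
  repeat match goal with |- context [cmul ?x ?y] => generalize (cmul x y) end;
  repeat match goal with |- context [cconj ?x] => generalize (cconj x) end;
  try generalize (@cone F); intros;
  apply/ffunP => k; rewrite ?(cayD, cayZ, cayN, cay_zeroE).

Lemma amul_E1E1 : amul (alb_E1 F) (alb_E1 F) = alb_E1 F.
Proof. by rewrite vecE amul_albv !zeroE !addE. Qed.

Lemma amul_E1Etilde : amul (alb_E1 F) (alb_Etilde F) = 0.
Proof. by rewrite !vecE amul_albv albv0 !zeroE !addE. Qed.

Lemma amul_EtildeEtilde : amul (alb_Etilde F) (alb_Etilde F) = alb_Etilde F.
Proof. by rewrite !vecE amul_albv !zeroE !addE. Qed.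

Lemma amul_E1nu x : amul (alb_E1 F) (nu im x) = 0.
Proof. by rewrite !vecE amul_albv albv0 !zeroE !addE. Qed.

Lemma amul_Etildenu x : amul (alb_Etilde F) (nu im x) = nu im x.
Proof.
rewrite !vecE amul_albv !zeroE !addE; congr albv.
by octonion_combination; field.
Qed.

Lemma amul_E1nu_pm s x : amul (alb_E1 F) (nu_pm im s x) = 2^-1 *: nu_pm im s x.
Proof. by rewrite !vecE amul_albv albvZ !zeroE !addE !scale1r. Qed.

Lemma amul_Etildenu_pm s x :
  amul (alb_Etilde F) (nu_pm im s x) = 2^-1 *: nu_pm im s x.
Proof. by rewrite !vecE amul_albv albvZ !zeroE !addE !scale1r. Qed.

Lemma amul_E1S_pm s : amul (alb_E1 F) (S_pm im s) = 0.
Proof. by rewrite !vecE amul_albv albv0 !zeroE !addE. Qed.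

Lemma amul_EtildeS_pm s : amul (alb_Etilde F) (S_pm im s) = S_pm im s.
Proof.
rewrite !vecE amul_albv !zeroE !addE; congr albv.
by octonion_combination; field.
Qed.

Lemma amul_nunu x y : amul (nu im x) (nu im y) = (- 2 * cpolar x y) *: alb_Etilde F.
Proof.
rewrite !vecE amul_albv albvZ !zeroE !addE !normE; congr albv; by field: him.
Qed.

(** Replacing im by -im exchanges S^+, nu_+ with S^-, nu_-; the sign s treats
   both cases at once. *)
Section PlusMinus.
Variable s : F.
Hypothesis ss : s ^+ 2 = 1.

Lemma amul_nunu_pm x y : cconj x = - x ->
  amul (nu im x) (nu_pm im s y) = nu_pm im s (s *: cmul y x).
Proof.
move=> xC; rewrite !vecE amul_albv !zeroE !addE !normE cconjM xC ?normE cmulNl cmulNr.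
by congr albv; octonion_combination; field: him ss.
Qed.

Lemma amul_nuS_pm x : cconj x = - x -> amul (nu im x) (S_pm im s) = 0.
Proof.
move=> xC; have x1 : cpolar x cone = 0.
  apply: (mulfI two0); rewrite mulr0.
  have := cpolar_conj x cone; rewrite xC cconj1 cpolarNl => E.
  have -> : 2 * cpolar x cone = cpolar x cone - - cpolar x cone by ring.
  by rewrite E subrr.
by rewrite !vecE amul_albv albv0 !zeroE !addE !normE x1 !addE addNr !addE.
Qed.

Lemma amul_nu_pm_same x y :
  amul (nu_pm im s x) (nu_pm im s y) = (2 * cpolar x y) *: S_pm im s.
Proof.
rewrite !vecE amul_albv albvZ !zeroE !addE !normE cpolar_conj.
have E : cmul (cconj x) y + cmul (cconj y) x = cpolar x y *: cone.
  by rewrite -cpolar_conj -cmul_conj_sym !cconjK.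
have -> b : (2 * cpolar x y) *: (b *: cone) =
    (2 * b) *: (cmul (cconj x) y + cmul (cconj y) x) :> cay F.
  by rewrite E !scalerA; congr (_ *: _); ring.
congr albv; first [by field: him ss | by octonion_combination; field].
Qed.

Lemma amul_nu_pm_opp x y : amul (nu_pm im s x) (nu_pm im (- s) y) =
  (2 * cpolar x y) *: (2 *: alb_E1 F + alb_Etilde F)
  + nu im (s *: (cmul (cconj y) x - cmul (cconj x) y)).
Proof.
rewrite !vecE amul_albv !albvZ albvD !(albvZ, albvD) !zeroE !addE !normE cpolar_conj.
congr albv; first [by field: him ss | by octonion_combination; field].
Qed.

Lemma amul_S_pm_nu_pm_same x : amul (S_pm im s) (nu_pm im s x) = 0.
Proof.
rewrite !vecE amul_albv albv0 !zeroE !addE !normE.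
congr albv; by octonion_combination; field: him ss.
Qed.

Lemma amul_S_pm_nu_pm_opp x : amul (S_pm im s) (nu_pm im (- s) x) = nu_pm im s x.
Proof.
rewrite !vecE amul_albv !zeroE !addE !normE.
congr albv; by octonion_combination; field: him ss.
Qed.

Lemma amul_S_pm_same : amul (S_pm im s) (S_pm im s) = 0.
Proof.
rewrite !vecE amul_albv albv0 !zeroE !addE !normE cpolar_cone !coneE.
congr albv; first [by field: him ss | by octonion_combination; field].
Qed.

Lemma amul_S_pm_opp : amul (S_pm im s) (S_pm im (- s)) = 2 *: alb_Etilde F.
Proof.
rewrite !vecE amul_albv albvZ !zeroE !addE !normE cpolar_cone !coneE.
congr albv; first [by field: him ss | by octonion_combination; field].
Qed.
End PlusMinus.

End MultiplicationTable.

(** * The decomposition is a grading *)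

Section Grading.
Variables (F : fieldType) (im : F).
Hypotheses (him : im ^+ 2 = -1) (two0 : (2 : F) != 0).
Local Notation G := (int * 'rV['Z_2]_3)%type.
Local Notation oct := (oct im).
Local Notation Gamma := (Gamma im).
Local Notation E1 := (alb_E1 F).
Local Notation Et := (alb_Etilde F).
Implicit Types (g h : G) (d e : 'rV['Z_2]_3) (b : bool) (x y : albert F).

(** The unit has trace 2, which is nonzero; the other basis octonions are
   orthogonal to it. *)
Lemma cay_comp_cap0 d :
  (cay_comp F d :&: cay0 F)%VS = (if (d == 0)%R then 0 else <[oct d]>)%VS.
Proof.
have K (x : cay F) : (x \in cay0 F) = (cpolar x cone == 0).
  by rewrite memv_ker lfunE.
rewrite (cay_compE him); case: eqVneq => [->|d0]; last first.
  by apply/capv_idPl; rewrite -memvE K -(oct0 him) oct_orth.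
apply/eqP; rewrite -subv0; apply/subvP => x; rewrite memv_cap K.
case/andP => /vlineP [c ->]; rewrite oct0 // cpolarZl cpolarxx -(oct0 him) oct_norm //.
by rewrite mulr1 mulf_eq0 (negPf two0) orbF => /eqP ->; rewrite scale0r mem0v.
Qed.

Lemma Gamma00 : Gamma (0, 0) = (<[E1]> + <[Et]>)%VS.
Proof. by rewrite /Defs.Gamma eqxx cay_comp_cap0 eqxx limg0 addv0. Qed.

Lemma Gamma0d d : d != 0 -> Gamma (0, d) = <[nu im (oct d)]>%VS.
Proof.
by move=> /negPf d0; rewrite /Defs.Gamma eqxx cay_comp_cap0 d0 limg_line lfunE add0v.
Qed.

Lemma Gamma_pm b d : Gamma ((-1) ^+ b, d) = <[nu_pm im ((-1) ^+ b) (oct d)]>%VS.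
Proof. by case: b; rewrite /Defs.Gamma /= (cay_compE him) limg_line lfunE. Qed.

Lemma Gamma_2 b : Gamma ((-1) ^+ b *+ 2, 0) = <[S_pm im ((-1) ^+ b)]>%VS.
Proof. by case: b; rewrite /Defs.Gamma /= eqxx. Qed.

Variant Gamma_spec : G -> Prop :=
| GammaDeg0 : Gamma_spec (0, 0)
| GammaNu d of d != 0 : Gamma_spec (0, d)
| GammaNuPm b d : Gamma_spec ((-1) ^+ b, d)
| GammaSPm b : Gamma_spec ((-1) ^+ b *+ 2, 0)
| GammaNone g of Gamma g = 0%VS : Gamma_spec g.

Lemma GammaP g : Gamma_spec g.
Proof.
case: g => n d.
have [->|n0] := eqVneq n 0.
  by have [->|d0] := eqVneq d 0; [exact: GammaDeg0 | exact: GammaNu].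
have [->|n1] := eqVneq n 1; first exact: (GammaNuPm false).
have [->|n_1] := eqVneq n (-1); first exact: (GammaNuPm true).
have [->|d0] := eqVneq d 0; last first.
  apply: GammaNone.
  by rewrite /Defs.Gamma (negPf n0) (negPf n1) (negPf n_1) (negPf d0) !andbF.
have [->|n2] := eqVneq n 2; first exact: (GammaSPm false).
have [->|n_2] := eqVneq n (-2); first exact: (GammaSPm true).
apply: GammaNone.
by rewrite /Defs.Gamma (negPf n0) (negPf n1) (negPf n_1) (negPf n2) (negPf n_2).
Qed.

(** Vectors spanning the components, on which linear statements are checked. *)
Variant generator : G -> albert F -> Prop :=
| GenE1 : generator (0, 0) E1
| GenEt : generator (0, 0) Et
| GenNu d of d != 0 : generator (0, d) (nu im (oct d))
| GenNuPm b d : generator ((-1) ^+ b, d) (nu_pm im ((-1) ^+ b) (oct d))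
| GenS b : generator ((-1) ^+ b *+ 2, 0) (S_pm im ((-1) ^+ b)).

Lemma generator_mem g x : generator g x -> x \in Gamma g.
Proof.
case=> [||d d0|b d|b]; rewrite ?Gamma00 ?Gamma0d ?Gamma_pm ?Gamma_2 ?memv_line //.
  by rewrite (subvP (addvSl _ _)) ?memv_line.
by rewrite (subvP (addvSr _ _)) ?memv_line.
Qed.

Lemma Gamma_sub g (V : {vspace albert F}) :
  (forall x, generator g x -> x \in V) -> (Gamma g <= V)%VS.
Proof.
case: (GammaP g) => [|d d0|b d|b|h ->] H; last exact: sub0v.
- by rewrite Gamma00 subv_add -!memvE !H //; [exact: GenEt | exact: GenE1].
- by rewrite Gamma0d // -memvE H //; exact: GenNu.
- by rewrite Gamma_pm -memvE H //; exact: GenNuPm.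
- by rewrite Gamma_2 -memvE H //; exact: GenS.
Qed.

Lemma nu_oct_mem c d : d != 0 -> nu im (c *: oct d) \in Gamma (0, d).
Proof. by move=> d0; rewrite linearZ memvZ ?generator_mem //; exact: GenNu. Qed.

Lemma nu_pm_oct_mem b c d :
  nu_pm im ((-1) ^+ b) (c *: oct d) \in Gamma ((-1) ^+ b, d).
Proof. by rewrite linearZ memvZ ?generator_mem //; exact: GenNuPm. Qed.

Let ss b : ((-1) ^+ b) ^+ 2 = 1 :> F.
Proof. by rewrite sqrr_sign. Qed.

Lemma generator_mul_nu_pm d b e : d != 0 ->
  amul (nu im (oct d)) (nu_pm im ((-1) ^+ b) (oct e))
  \in Gamma ((0, d) + ((-1) ^+ b, e)).
Proof.
move=> d0; rewrite amul_nunu_pm // ?oct_conj // oct_mul // scalerA.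
have -> : (0, d) + ((-1) ^+ b, e) = ((-1) ^+ b, e + d) :> G.
  by congr (_, _); rewrite /= (add0r, addrC).
exact: nu_pm_oct_mem.
Qed.

(** Degrees d and e which differ kill the part in n(x, y), and equal ones kill
   the commutator part. *)
Lemma generator_mul_pm_pm b d b' e :
  amul (nu_pm im ((-1) ^+ b) (oct d)) (nu_pm im ((-1) ^+ b') (oct e))
  \in Gamma (((-1) ^+ b, d) + ((-1) ^+ b', e)).
Proof.
have [-> {b'}|] := eqVneq b' b.
  rewrite amul_nu_pm_same // ; have [->|de] := eqVneq d e; last first.
    by rewrite oct_orth // mulr0 scale0r mem0v.
  apply: memvZ; have -> : ((-1) ^+ b, e) + ((-1) ^+ b, e) = ((-1) ^+ b *+ 2, 0) :> G.
    by congr (_, _); rewrite row2_addrr.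
  by apply: generator_mem; exact: GenS.
move=> nb; have -> : b' = ~~ b by case: b b' nb => [] [].
have -> : ((-1) ^+ b, d) + ((-1) ^+ ~~ b, e) = (0, d + e) :> G.
  by congr (_, _); rewrite signrN subrr.
rewrite signrN amul_nu_pm_opp //; have [->|de] := eqVneq d e.
  rewrite subrr scaler0 linear0 addr0 row2_addrr memvZ // memvD // ?memvZ //;
  by apply: generator_mem; constructor.
rewrite oct_orth // mulr0 scale0r add0r !oct_conjE // !cmulZl !oct_mul // (addrC e d).
rewrite !scalerA -scalerBl scalerA; apply: nu_oct_mem.
by rewrite addr_eq0 row2_oppr.
Qed.

Let sumG n d n' d' : (n, d) + (n', d') = (n + n', d + d') :> G.
Proof. by []. Qed.

Lemma generator_mul g h x y :
  generator g x -> generator h y -> amul x y \in Gamma (g + h).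
Proof.
have E0 h' : (0, 0) + h' = h' :> G by exact: add0r.
have mE b : ((-1) ^+ b *+ 2 : int) = (-1) ^+ b + (-1) ^+ b by rewrite mulr2n.
pose bilin := (amul_E1E1 two0, amul_E1Etilde two0, amul_EtildeEtilde two0,
  amul_E1nu im two0, amul_Etildenu im two0,
  amul_E1nu_pm im two0, amul_Etildenu_pm im two0,
  amul_E1S_pm im two0, amul_EtildeS_pm im two0).
have GE y' h' : generator h' y' -> amul E1 y' \in Gamma h' /\ amul Et y' \in Gamma h'.
  by move=> gy; have := generator_mem gy; case: gy => [||d d0|b d|b] yG;
    split; rewrite ?(amulC two0 Et E1) ?bilin;
    first [exact: yG | exact: mem0v | exact: memvZ yG].
have S0 b d : d != 0 -> amul (nu im (oct d)) (S_pm im ((-1) ^+ b)) = 0.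
  by move=> d0; apply: (amul_nuS_pm im two0); rewrite ?oct_conj.
have SN b b' d : amul (S_pm im ((-1) ^+ b)) (nu_pm im ((-1) ^+ b') (oct d))
    \in Gamma ((-1) ^+ b *+ 2 + (-1) ^+ b', 0 + d).
  have [->|nb] := eqVneq b' b; first by rewrite amul_S_pm_nu_pm_same ?mem0v.
  have -> : b' = ~~ b by case: b b' nb => [] [].
  have -> : ((-1) ^+ b *+ 2 + (-1) ^+ ~~ b, 0 + d) = ((-1) ^+ b, d) :> G.
    by rewrite mE signrN addrK add0r.
  rewrite signrN amul_S_pm_nu_pm_opp //.
  by apply: generator_mem; exact: GenNuPm.
case=> [||d d0|b d|b].
- by case/GE; rewrite E0.
- by case/GE; rewrite E0.
- case=> [||e e0|b' e|b'].
  + by rewrite amulC // addrC E0; case: (GE _ _ (GenNu d0)).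
  + by rewrite amulC // addrC E0; case: (GE _ _ (GenNu d0)).
  + rewrite amul_nunu // sumG addr0; have [->|de] := eqVneq d e.
      by rewrite row2_addrr memvZ // generator_mem //; constructor.
    by rewrite oct_orth // mulr0 scale0r mem0v.
  + exact: generator_mul_nu_pm.
  + by rewrite S0 // mem0v.
- case=> [||e e0|b' e|b'].
  + by rewrite amulC // addrC E0; case: (GE _ _ (GenNuPm b d)).
  + by rewrite amulC // addrC E0; case: (GE _ _ (GenNuPm b d)).
  + by rewrite amulC // addrC; exact: generator_mul_nu_pm.
  + exact: generator_mul_pm_pm.
  + by rewrite amulC // addrC; exact: SN.
case=> [||e e0|b' e|b'].
- by rewrite amulC // addrC E0; case: (GE _ _ (GenS b)).
- by rewrite amulC // addrC E0; case: (GE _ _ (GenS b)).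
- by rewrite amulC // S0 // mem0v.
- exact: SN.
have [->|nb] := eqVneq b' b; first by rewrite amul_S_pm_same ?mem0v.
have -> : b' = ~~ b by case: b b' nb => [] [].
rewrite signrN amul_S_pm_opp // sumG addr0 signrN mulNrn subrr.
by rewrite memvZ // generator_mem //; constructor.
Qed.

Lemma Gamma_mul g h x y :
  x \in Gamma g -> y \in Gamma h -> amul x y \in Gamma (g + h).
Proof.
have step u v k : (forall z, generator v z -> amul u z \in Gamma k) ->
    forall z, z \in Gamma v -> amul u z \in Gamma k.
  move=> H z; have : (Gamma v <= linfun (amul u) @^-1: Gamma k)%VS.
    by apply: Gamma_sub => w /H; rewrite -memv_preim lfunE.
  by move=> /subvP S /S; rewrite -memv_preim lfunE.
move=> xG; apply: (step) => z gz; rewrite amulC // addrC.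
move: xG; apply: step => w gw.
by rewrite amulC // addrC; apply: generator_mul.
Qed.

Definition alb_trace x : F := \sum_i (x.1 i : F).

Fact alb_trace_linear : linear (alb_trace : albert F -> F^o).
Proof.
move=> a x y; rewrite /alb_trace scaler_sumr -big_split; apply: eq_bigr => i _.
by rewrite !ffunE.
Qed.
HB.instance Definition _ :=
  GRing.isLinear.Build F (albert F) F^o *:%R alb_trace alb_trace_linear.

Lemma alb_traceZ c x : alb_trace (c *: x) = c * alb_trace x.
Proof. exact: (linearZ_LR alb_trace). Qed.

Lemma alb_traceD x y : alb_trace (x + y) = alb_trace x + alb_trace y.
Proof. exact: (linearD alb_trace). Qed.

Lemma alb_trace0 : alb_trace 0 = 0.
Proof. by rewrite -(scale0r (0 : albert F)) alb_traceZ mul0r. Qed.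

Lemma alb_trace_albv a0 a1 a2 (x0 x1 x2 : cay F) :
  alb_trace (albv a0 a1 a2 x0 x1 x2) = a0 + a1 + a2.
Proof. by rewrite /alb_trace sum_Z3 albv.unlock !ffunE. Qed.

Lemma Gamma_trace g x : x \in Gamma g -> g != 0 -> alb_trace x = 0.
Proof.
case: (GammaP g) => [|d d0|b d|b|h' ->].
- by rewrite eqxx.
- rewrite Gamma0d // => /vlineP [c ->] _.
  by rewrite alb_traceZ nuE alb_trace_albv !addr0 mulr0.
- rewrite Gamma_pm // => /vlineP [c ->] _.
  by rewrite alb_traceZ nu_pmE alb_trace_albv !addr0 mulr0.
- rewrite Gamma_2 // => /vlineP [c ->] _.
  by rewrite alb_traceZ S_pmE // alb_trace_albv addr0 subrr mulr0.
by rewrite memv0 => /eqP -> _; exact: alb_trace0.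
Qed.

Let trE1 : alb_trace E1 = 1.
Proof. by rewrite alb_E1E alb_trace_albv add0r addr0. Qed.

Let trEt : alb_trace Et = 2.
Proof. by rewrite alb_EtildeE alb_trace_albv addr0. Qed.

Let octxx d : cpolar (oct d) (oct d) = 2.
Proof. by rewrite cpolarxx oct_norm // mulr1. Qed.

Lemma amul_nu_pm_trace b d :
  alb_trace (amul (nu_pm im ((-1) ^+ b) (oct d)) (nu_pm im ((-1) ^+ ~~ b) (oct d)))
  = 2 * 2 * (2 * 2).
Proof.
rewrite signrN amul_nu_pm_opp // octxx subrr scaler0 linear0 addr0.
by rewrite alb_traceZ alb_traceD alb_traceZ trE1 trEt; ring.
Qed.

(** The trace form pairs the component of degree g with that of degree -g
   without kernel; in degree 0 it is diagonal on the two idempotents. *)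
Lemma Gamma_pairing g x : x \in Gamma g -> x != 0 ->
  exists2 y, y \in Gamma (- g) & alb_trace (amul x y) != 0.
Proof.
have line c v w (U : {vspace albert F}) :
    c *: v != 0 -> w \in U -> alb_trace (amul w v) != 0 ->
    exists2 y, y \in U & alb_trace (amul (c *: v) y) != 0.
  rewrite scaler_eq0 negb_or => /andP [c0 _] wG t0; exists w; first exact: wG.
  rewrite (amulC two0) (linearZ_LR (amul w)) alb_traceZ; exact: mulf_neq0 c0 t0.
case: (GammaP g) => [|d d0|b d|b|h ->]; last by rewrite memv0 => ->.
- rewrite oppr0 Gamma00 => /memv_addP [u /vlineP [a ->] [v /vlineP [b ->] ->]] nz.
  have [a0|a0] := eqVneq a 0.
    exists Et; first by rewrite -Gamma00 generator_mem //; constructor.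
    move: nz; rewrite a0 scale0r add0r scaler_eq0 negb_or => /andP [b0 _].
    rewrite amulC // linearZ_LR /= amul_EtildeEtilde // alb_traceZ trEt.
    by rewrite mulf_neq0.
  exists E1; first by rewrite -Gamma00 generator_mem //; constructor.
  rewrite amulC // linearD !linearZ_LR /= amul_E1E1 // amul_E1Etilde // scaler0 addr0.
  by rewrite alb_traceZ trE1 mulr1.
- have -> : - (0, d) = (0, d) :> G by congr (_, _); rewrite row2_oppr.
  rewrite Gamma0d // => /vlineP [c ->] nz; apply: line nz (memv_line _) _.
  by rewrite amul_nunu // alb_traceZ trEt octxx !mulf_neq0 // oppr_eq0.
- have -> : - ((-1) ^+ b, d) = ((-1) ^+ ~~ b, d) :> G.
    by congr (_, _); rewrite ?row2_oppr // signrN.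
  rewrite !Gamma_pm => /vlineP [c ->] nz; apply: line nz (memv_line _) _.
  by rewrite amulC // amul_nu_pm_trace !mulf_neq0.
have -> : - ((-1) ^+ b *+ 2, 0) = ((-1) ^+ (~~ b) *+ 2, 0) :> G.
  by rewrite signrN mulNrn; congr (_, _); rewrite oppr0.
rewrite !Gamma_2 => /vlineP [c ->] nz; apply: line nz (memv_line _) _.
by rewrite amulC // signrN amul_S_pm_opp // alb_traceZ trEt mulf_neq0.
Qed.

(** If x had two degrees g and h, the product with a partner of degree -g would
   have a degree h - g other than 0, hence trace zero. *)
Lemma Gamma_degree g h x : x \in Gamma g -> x \in Gamma h -> x != 0 -> g = h.
Proof.
move=> xg xh /(Gamma_pairing xg) [y yg]; apply: contraNeq => gh; apply/eqP.
by apply: Gamma_trace (Gamma_mul xh yg) _; rewrite subr_eq0 eq_sym.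
Qed.

Lemma oct_neq0 d : oct d != 0.
Proof.
apply: contraTneq isT => E; have := octxx d.
by rewrite E cpolarx0 => /esym/eqP; rewrite (negPf two0).
Qed.

Lemma nu_pm_neq0 s (z : cay F) : z != 0 -> nu_pm im s z != 0.
Proof.
apply: contra => /eqP; rewrite nu_pmE => /(congr1 (fun x : albert F => x.2 2)).
rewrite albv.unlock !ffunE /= => /eqP.
by rewrite scaler_eq0 (negPf two0).
Qed.

Lemma nu_neq0 (z : cay F) : z != 0 -> nu im z != 0.
Proof.
apply: contra => /eqP; rewrite nuE => /(congr1 (fun x : albert F => x.2 1)).
rewrite albv.unlock !ffunE /= => /eqP.
by rewrite scaler_eq0 mulf_eq0 (negPf two0) (negPf (im_neq0 him)).
Qed.

Lemma S_pm_neq0 s : S_pm im s != 0.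
Proof.
apply/eqP; rewrite S_pmE // => /(congr1 (fun x : albert F => x.1 0)).
by rewrite albv.unlock !ffunE /= => /eqP; rewrite oner_eq0.
Qed.

Lemma E1_neq0 : E1 != 0.
Proof.
apply/eqP; rewrite alb_E1E => /(congr1 (fun x : albert F => x.1 1)).
by rewrite albv.unlock !ffunE /= => /eqP; rewrite oner_eq0.
Qed.

(** Pairs of degrees on which any permutation of the components induced by an
   automorphism has to be additive. *)
Definition nonzero_product g h :=
  exists x y, [/\ x \in Gamma g, y \in Gamma h & amul x y != 0].

Lemma nonzero_product00 : nonzero_product 0 0.
Proof.
by exists E1, E1; rewrite amul_E1E1 // E1_neq0 !generator_mem //; constructor.
Qed.

Lemma nonzero_product_nu d b e :
  d != 0 -> nonzero_product (0, d) ((-1) ^+ b, e).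
Proof.
move=> d0; exists (nu im (oct d)), (nu_pm im ((-1) ^+ b) (oct e)).
split; try by apply: generator_mem; constructor.
rewrite amul_nunu_pm ?oct_conj // oct_mul // nu_pm_neq0 // !scaler_eq0.
by rewrite !signr_eq0 oct_neq0.
Qed.

Lemma nonzero_product_opp b d :
  nonzero_product ((-1) ^+ b, d) ((-1) ^+ ~~ b, d).
Proof.
exists (nu_pm im ((-1) ^+ b) (oct d)), (nu_pm im ((-1) ^+ ~~ b) (oct d)).
split; try by apply: generator_mem; constructor.
have := amul_nu_pm_trace b d; apply: contra_eqN => /eqP ->.
by rewrite alb_trace0 eq_sym !mulf_neq0.
Qed.

Lemma nonzero_product_same b d :
  nonzero_product ((-1) ^+ b, d) ((-1) ^+ b, d).
Proof.
exists (nu_pm im ((-1) ^+ b) (oct d)), (nu_pm im ((-1) ^+ b) (oct d)).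
split; try by apply: generator_mem; constructor.
by rewrite amul_nu_pm_same // octxx scaler_eq0 (negPf (S_pm_neq0 _)) orbF mulf_neq0.
Qed.

End Grading.

(** * From automorphisms of the grading to automorphisms of the group *)

Section WeylAction.
Variables (F : fieldType) (im : F).
Hypotheses (him : im ^+ 2 = -1) (two0 : (2 : F) != 0).
Local Notation G := (int * 'rV['Z_2]_3)%type.
Local Notation oct := (oct im).
Local Notation Gamma := (Gamma im).
Local Notation Weyl := (weyl (@amul F) Gamma).
Implicit Types (g h : G) (d e : 'rV['Z_2]_3) (b : bool) (f : algaut (@amul F)).
Implicit Types (phi psi : gaut (@amul F) Gamma).

Lemma morph_intpair (u : G -> G) : {morph u : x y / x + y} ->
  forall n d, u (n, d) = u (1, 0) *~ n + u (0, d).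
Proof.
move=> uD n d.
have u0 : u 0 = 0 by apply: (addrI (u 0)); rewrite -uD !addr0.
have uB : {morph u : x y / x - y}.
  by move=> x y; apply: (addIr (u y)); rewrite -uD !subrK.
pose U : {additive G -> G} := HB.pack u (GRing.isZmodMorphism.Build _ _ u uB).
have -> : (n, d) = (1, 0) *~ n + (0, d).
  have P m : (1, 0) *~ m = (m, 0) :> G.
    have Pn (k : nat) : (1, 0) *+ k = (k%:Z, 0) :> G.
      by elim: k => [|k IH]; rewrite ?mulr0n // mulrS IH; congr (_, _); rewrite addr0.
    case: m => k; first exact: Pn.
    by rewrite NegzE mulrNz -pmulrn Pn; congr (_, _); rewrite oppr0.
  by rewrite P; congr (_, _); rewrite ?addr0 ?add0r.
by rewrite uD -[u (_ *~ _)]/(U _) raddfMz.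
Qed.

Lemma gsupp_generator g x : generator im g x -> gsupp Gamma g.
Proof.
move=> gx; rewrite /gsupp; apply: contraTneq (generator_mem him two0 gx) => ->.
rewrite memv0; case: gx => [||d d0|b d|b].
- exact: E1_neq0.
- apply: contra (S_pm_neq0 im two0 1) => /eqP E.
  by rewrite -(amul_EtildeS_pm im two0) E amulC // linear0.
- by rewrite nu_neq0 // oct_neq0.
- by rewrite nu_pm_neq0 // oct_neq0.
- exact: S_pm_neq0.
Qed.

Lemma gsupp0 d : gsupp Gamma (0, d).
Proof.
have [->|d0] := eqVneq d 0.
  exact: gsupp_generator (GenE1 im).
exact: gsupp_generator (GenNu im d0).
Qed.

Lemma gsupp1 b d : gsupp Gamma ((-1) ^+ b, d).
Proof. exact: gsupp_generator (GenNuPm im b d). Qed.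

Lemma Gamma_inj g h : gsupp Gamma g -> Gamma g = Gamma h -> g = h.
Proof.
rewrite /gsupp -vpick0 => nz E; apply: (Gamma_degree him two0 (memv_pick _) _ nz).
by rewrite -E memv_pick.
Qed.

Lemma algaut_img_eq0 f (U : {vspace albert F}) : ((f @: U)%VS == 0%VS) = (U == 0%VS).
Proof.
by rewrite -!dimv_eq0 limg_dim_eq // (eqP (algaut_inj f)) capv0.
Qed.

(** The image of a nonzero product x y has degree p (g + h), and also degree
   p g + p h since it is the product of the images. *)
Lemma degree_permutation_add f (p : G -> G) g h :
    (forall k, (f @: Gamma k)%VS = Gamma (p k)) ->
  nonzero_product im g h -> p (g + h) = p g + p h.
Proof.
move=> fp [x [y [xg yh nz]]]; have fG k z : z \in Gamma k -> f z \in Gamma (p k).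
  by move=> zk; rewrite -fp memv_img.
apply: (@Gamma_degree _ _ him two0 _ _ (f (amul x y))).
- by apply: fG; apply: Gamma_mul.
- by rewrite algaut_morph; apply: Gamma_mul => //; apply: fG.
apply: contraNneq nz => E; apply/eqP; apply: (lker0P (algaut_inj f)).
by rewrite E linear0.
Qed.

(** Write r d = p (0, d) and q for the value of p at (1, 0). The products of
   degrees (0, d) and (1, e) give p (1, d + e) = r d + p (1, e), hence r is
   additive and p (1, d) = r d + q. The products of degrees (1, 0) and (-1, 0),
   and the squares in degrees (1, 0) and (-1, 0), then give the other values. *)
Lemma degree_morphism f :
    (forall g, gsupp Gamma g -> exists h, (f @: Gamma g)%VS = Gamma h) ->
  exists2 u : G -> G, {morph u : x y / x + y} &
    forall g, gsupp Gamma g -> (f @: Gamma g)%VS = Gamma (u g).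
Proof.
move=> fH.
(* outside the support any degree can be chosen, all components being 0 *)
have /choice [p pE] : forall g, exists h, (f @: Gamma g)%VS = Gamma h.
  move=> g; have [/fH //|/negPn/eqP E] := boolP (gsupp Gamma g).
  by exists g; rewrite E limg0.
have pD := degree_permutation_add pE.
pose r d := p (0, d); pose q b := p ((-1) ^+ b, 0).
have r0 : r 0 = 0.
  by apply: (addrI (p 0)); rewrite -pD ?addr0 //; exact: nonzero_product00.
have pr b d e : p ((-1) ^+ b, d + e) = r d + p ((-1) ^+ b, e).
  have [->|d0] := eqVneq d 0; first by rewrite r0 !add0r.
  rewrite -pD; last exact: nonzero_product_nu.
  by congr p; congr (_, _); rewrite /= add0r.
have pq b d : p ((-1) ^+ b, d) = r d + q b by rewrite -pr addr0.
have rD : {morph r : d e / d + e}.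
  by move=> d e; apply: (addIr (q false)); rewrite -pq pr pq addrA.
have qN b : q (~~ b) = - q b.
  apply: (addrI (q b)); rewrite subrr -r0 -pD; last exact: nonzero_product_opp.
  by congr p; congr (_, _); rewrite /= ?addr0 // signrN subrr.
have q2 b : p ((-1) ^+ b *+ 2, 0) = q b *+ 2.
  rewrite [RHS]mulr2n -pD; last exact: nonzero_product_same.
  by congr p; congr (_, _); rewrite addr0.
exists (fun g => q false *~ g.1 + r g.2).
  by move=> [n d] [n' d']; rewrite /= rD mulrzDr addrACA.
move=> g; rewrite pE => sg; congr Gamma; move: sg.
case: (GammaP im g) => [|d d0|b d|b|h Eh] /=; rewrite ?mulr0z ?add0r //.
- by rewrite pq addrC; case: b; rewrite ?(qN false).
- rewrite q2 r0 addr0; case: b => //.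
  by move=> _; rewrite (qN false : q true = - q false) mulNrn.
by rewrite /gsupp Eh eqxx.
Qed.

Lemma gaut_imgK phi (U : {vspace albert F}) : ((phi^-1)%g @: (phi @: U))%VS = U.
Proof. by rewrite -limg_comp (lker0_compVf (algaut_inj phi)) lim1g. Qed.

(** The degree maps of phi and of its inverse are mutually inverse on the
   support, which generates the group. *)
Lemma gaut_degree phi : exists u : zaut G,
  forall g, gsupp Gamma g -> (phi @: Gamma g)%VS = Gamma (u g).
Proof.
have H psi : exists2 u : G -> G, {morph u : x y / x + y} &
    forall g, gsupp Gamma g -> (psi @: Gamma g)%VS = Gamma (u g).
  apply: degree_morphism => g sg.
  have [P _] : permutes_components Gamma psi := asboolW (gautP psi).
  by have [h _ E] := P g sg; exists h.
have supp psi u g :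
    (psi @: Gamma g)%VS = Gamma (u g) -> gsupp Gamma g -> gsupp Gamma (u g).
  by rewrite /gsupp => <-; rewrite algaut_img_eq0.
have cancel_supp psi chi u v : cancel (fun U => (psi @: U)%VS) (fun U => (chi @: U)%VS) ->
    {morph u : x y / x + y} -> {morph v : x y / x + y} ->
    (forall g, gsupp Gamma g -> (psi @: Gamma g)%VS = Gamma (u g)) ->
    (forall g, gsupp Gamma g -> (chi @: Gamma g)%VS = Gamma (v g)) -> cancel u v.
  move=> K uD vD uE vE.
  have vuD : {morph v \o u : x y / x + y} by move=> x y /=; rewrite uD vD.
  have vu g : gsupp Gamma g -> (v \o u) g = g.
    move=> sg; have Eu := uE g sg; have Ev := vE _ (supp psi u g Eu sg).
    by apply/esym/(Gamma_inj sg); rewrite /= -Ev -Eu K.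
  move=> [n d]; have := morph_intpair vuD n d; rewrite /= => ->.
  rewrite -!/((v \o u) _) !vu ?gsupp0 ?(gsupp1 false) //.
  exact/esym/(@morph_intpair id).
have [u uD uE] := H phi; have [v vD vE] := H (phi^-1)%g.
have vK : cancel (fun U => ((phi^-1)%g @: U)%VS) (fun U => (phi @: U)%VS).
  by move=> U; have := gaut_imgK (phi^-1)%g U; rewrite invgK.
have ub : bijective u.
  exists v; first exact: cancel_supp (gaut_imgK phi) uD vD uE vE.
  exact: cancel_supp vK vD uD vE uE.
by exists (ZAut uD ub).
Qed.

Lemma degree_action_unique f (u v : zaut G) :
    (forall g, gsupp Gamma g -> (f @: Gamma g)%VS = Gamma (u g)) ->
    (forall g, gsupp Gamma g -> (f @: Gamma g)%VS = Gamma (v g)) -> u = v.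
Proof.
move=> uE vE; have uv g : gsupp Gamma g -> u g = v g.
  move=> sg; apply: Gamma_inj; first by rewrite /gsupp -uE // algaut_img_eq0.
  by rewrite -uE // vE.
apply: zaut_eq => -[n d]; rewrite (morph_intpair (zaut_morph u)).
by rewrite (morph_intpair (zaut_morph v)) !uv ?gsupp0 ?(gsupp1 false).
Qed.

Definition gaut_zaut phi : zaut G := projT1 (cid (gaut_degree phi)).

Lemma gaut_zautE phi g :
  gsupp Gamma g -> (phi @: Gamma g)%VS = Gamma (gaut_zaut phi g).
Proof. exact: (projT2 (cid (gaut_degree phi))). Qed.

Lemma gstab_imgP phi psi :
  (phi^-1 * psi)%g \in @gstab _ _ (@amul F) _ Gamma <->
  forall g, (phi @: Gamma g)%VS = (psi @: Gamma g)%VS.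
Proof.
split=> [/asboolP H g|H].
  have /= := H g; rewrite limg_comp => E.
  have := gaut_imgK (phi^-1)%g (psi @: Gamma g)%VS; rewrite invgK /= => <-.
  by rewrite E.
by apply/asboolP => g; rewrite /= limg_comp -H; exact: gaut_imgK.
Qed.

Definition weyl_zaut (w : Weyl) : zaut G := gaut_zaut (repr w).

Lemma weyl_zautE phi g : gsupp Gamma g ->
  (phi @: Gamma g)%VS = Gamma (weyl_zaut (weyl_class phi) g).
Proof.
move=> sg; rewrite /weyl_zaut -gaut_zautE //.
have [H _] := gstab_imgP phi (repr (weyl_class phi)).
by apply: H; apply/weyl_classP; rewrite weyl_classK.
Qed.

Lemma weyl_zaut_unique phi (u : zaut G) :
    (forall g, gsupp Gamma g -> (phi @: Gamma g)%VS = Gamma (u g)) ->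
  weyl_zaut (weyl_class phi) = u.
Proof. by move=> uE; apply: degree_action_unique uE => g; exact: weyl_zautE. Qed.

Fact weyl_zautM : {morph weyl_zaut : w w' / (w * w')%g}.
Proof.
move=> w w'; have [phi ->] := weyl_class_surj w; have [psi ->] := weyl_class_surj w'.
rewrite -[(_ * _)%g]/(weyl_mul _ _) weyl_mulE; apply: weyl_zaut_unique => g sg.
rewrite /= limg_comp (weyl_zautE psi) // (weyl_zautE phi) //.
by rewrite /gsupp -weyl_zautE // algaut_img_eq0.
Qed.
HB.instance Definition _ := isMultiplicative.Build Weyl (zaut G) weyl_zaut weyl_zautM.

Lemma weyl_zaut_inj : injective weyl_zaut.
Proof.
move=> w w'; have [phi ->] := weyl_class_surj w; have [psi ->] := weyl_class_surj w'.
move=> E; apply/weyl_classP/gstab_imgP => g.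
have [sg|/negPn/eqP ->] := boolP (gsupp Gamma g); last by rewrite !limg0.
by rewrite (weyl_zautE phi) // E -weyl_zautE.
Qed.

End WeylAction.

(** * Realizing every automorphism of the group *)

Section Realization.
Variables (F : fieldType) (im : F).
Hypotheses (him : im ^+ 2 = -1) (two0 : (2 : F) != 0).
Local Notation G := (int * 'rV['Z_2]_3)%type.
Local Notation oct := (oct im).
Local Arguments Gamma : simpl never.
Local Notation Gamma := (Gamma im).
Local Notation endo := {linear cay F -> cay F}.
Implicit Types (g h : G) (a d e : 'rV['Z_2]_3) (b : bool) (f : algaut (@amul F)).

(** Inclusions are stable under composition and can be checked on spanning
   vectors; they become equalities as soon as the inverse of u is realizable
   too. *)
Definition realizable (u : G -> G) :=
  exists f, forall g, (f @: Gamma g <= Gamma (u g))%VS.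

Lemma realizable_comp u v : realizable u -> realizable v -> realizable (u \o v).
Proof.
move=> [f fu] [f' fv]; exists (f * f')%g => g.
by rewrite /= limg_comp (subv_trans _ (fu (v g))) // limgS.
Qed.

Lemma realizable_ext u v : u =1 v -> realizable u -> realizable v.
Proof. by move=> E [f fu]; exists f => g; rewrite -E. Qed.

Lemma alb_map_albv (m : 'Z_3 -> endo) (t0 t1 t2 : F) x0 x1 x2 :
  alb_map m (albv t0 t1 t2 x0 x1 x2) = albv t0 t1 t2 (m 0 x0) (m 1 x1) (m 2 x2).
Proof.
rewrite albv.unlock /alb_map /=; congr (_, _); apply/ffunP.
by elim/Z3P; rewrite !ffunE.
Qed.

Lemma realizable_triple (m : 'Z_3 -> endo) (u : G -> G) :
    (forall i x y, cpolar (m i x) (m i y) = cpolar x y) ->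
    (forall i x y, m (i + 2) (cmul (cconj x) (cconj y)) =
       cmul (cconj (m i x)) (cconj (m (i + 1) y))) ->
    u (0, 0) = (0, 0) ->
    (forall d, d != 0 -> alb_map m (nu im (oct d)) \in Gamma (u (0, d))) ->
    (forall b d, alb_map m (nu_pm im ((-1) ^+ b) (oct d))
       \in Gamma (u ((-1) ^+ b, d))) ->
    (forall b, alb_map m (S_pm im ((-1) ^+ b)) \in Gamma (u ((-1) ^+ b *+ 2, 0))) ->
  realizable u.
Proof.
move=> mP mT u0 mN mNP mS; have [f fE] := alb_map_aut two0 mP mT.
exists f => g; apply/subvP => _ /memv_imgP [x xg ->].
suff /subvP/(_ x xg) : (Gamma g <= f @^-1: Gamma (u g))%VS by rewrite -memv_preim.
apply: (Gamma_sub him two0) => z gz; rewrite -memv_preim fE.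
case: gz => [||d d0|b d|b]; rewrite ?mN ?mNP ?mS // u0.
  by rewrite alb_E1E alb_map_albv !linear0 -alb_E1E generator_mem //; constructor.
by rewrite alb_EtildeE alb_map_albv !linear0 -alb_EtildeE generator_mem //; constructor.
Qed.

Definition flip_triple (i : 'Z_3) : endo :=
  if i == 2 then (idfun : endo) else (-%R : endo).

(** Negating the slots of iota_1 and iota_3 acts on nu_+, nu_-, S^+ and S^- as a
   change of the sign of im, which exchanges + and -. *)
Lemma realizable_flip : realizable (fun g => (- g.1, g.2)).
Proof.
apply: (realizable_triple (m := flip_triple)) => [i x y|i x y||d d0|b d|b].
- by elim/Z3P: i => //=; rewrite cpolarNl cpolarNr opprK.
- by elim/Z3P: i => /=; rewrite ?linearN /= ?cmulNl ?cmulNr ?opprK.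
- by rewrite /= oppr0.
- rewrite nuE alb_map_albv /= oppr0 -scalerN -nuE oppr0.
  by rewrite -scaleN1r nu_oct_mem.
- rewrite nu_pmE alb_map_albv /= oppr0 -scaleNr -mulNr -mulrN.
  by rewrite -nu_pmE -!signrN -(scale1r (oct d)) nu_pm_oct_mem.
- rewrite S_pmE // alb_map_albv /= oppr0 -scaleNr -mulNr -S_pmE // -mulNrn -!signrN.
  by rewrite generator_mem //; constructor.
Qed.

Section Translation.
Variable a : 'rV['Z_2]_3.
Hypothesis a0 : a != 0.
Let c := oct a.
Let cC : cconj c = - c. Proof. exact: oct_conj. Qed.
Let cK x : cmul c (cmul c x) = - x.
Proof.
have := cconj_mulK c x; rewrite cC cmulNl oct_norm // scale1r.
by move/(congr1 -%R); rewrite opprK.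
Qed.
Let Kc x : cmul (cmul x c) c = - x.
Proof.
have := cmul_conjK x c; rewrite cC cmulNr cmulNl oct_norm // scale1r.
by move/(congr1 -%R); rewrite opprK.
Qed.

(** The signs make the map on the slot 1 fix the unit, as c (1 c) = -1, and
   hence S^+ and S^-. *)
Definition translation_triple (i : 'Z_3) : endo :=
  if i == 0 then (\- cmul c : endo)
  else if i == 1 then (\- (cmul c \o cmulr c) : endo) else (cmulr c : endo).
Local Notation m := translation_triple.

Let m0E x : m 0 x = - cmul c x. Proof. by []. Qed.
Let m1E x : m 1 x = - cmul c (cmul x c). Proof. by []. Qed.
Let m2E x : m 2 x = cmul x c. Proof. by []. Qed.

Lemma translation_polar i x y : cpolar (m i x) (m i y) = cpolar x y.
Proof.
have L z t : cpolar (cmul c z) (cmul c t) = cpolar z t.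
  by rewrite cpolar_mull cC cmulNl cK opprK.
have R z t : cpolar (cmul z c) (cmul t c) = cpolar z t.
  by rewrite cpolar_mulr cC cmulNr Kc opprK.
by elim/Z3P: i; rewrite ?m0E ?m1E ?m2E ?cpolarNl ?cpolarNr ?opprK ?L ?R.
Qed.

Lemma translation_related i x y : m (i + 2) (cmul (cconj x) (cconj y)) =
  cmul (cconj (m i x)) (cconj (m (i + 1) y)).
Proof.
have C0 z : cconj (m 0 z) = cmul (cconj z) c.
  by rewrite m0E cconjN cconjM cC cmulNr opprK.
have C1 z : cconj (m 1 z) = - cmul c (cmul (cconj z) c).
  by rewrite m1E cconjN !cconjM cC cmulNl cmulNr cmulNl opprK cmul_flex.
have C2 z : cconj (m 2 z) = - cmul c (cconj z).
  by rewrite m2E cconjM cC cmulNl.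
elim/Z3P: i; rewrite ?Z3E.
- by rewrite (C0 x) (C1 y) cmulNr moufang_right Kc !cmulNl opprK.
- by rewrite (C1 x) (C2 y) cmulNl cmulNr opprK -moufang_left cK !cmulNr.
- by rewrite (C2 x) (C0 y) cmulNl moufang_mid.
Qed.

(** The maps on the slots 0 and 2 correspond under conjugation, so that the
   triple multiplies the argument of nu_+ and nu_- by c on the right. *)
Lemma translation_conj x : m 0 (cconj x) = cconj (m 2 x).
Proof. by rewrite m0E m2E cconjM cC cmulNl. Qed.

Lemma realizable_translation : realizable (fun g => (g.1, g.2 + a *~ g.1)).
Proof.
apply: (realizable_triple translation_polar translation_related) => [|d d0|b d|b].
- by rewrite /= add0r mulr0z.
- rewrite nuE alb_map_albv !linear0 linearZ_LR -nuE m1E /= mulr0z addr0.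
  rewrite /c oct_mul // cmulZr oct_mul // addrCA row2_addrr addr0.
  by rewrite scalerA -scaleNr nu_oct_mem.
- rewrite nu_pmE alb_map_albv !linear0 !linearZ_LR translation_conj -nu_pmE m2E /=.
  have -> : a *~ (-1) ^+ b = a by case: b; rewrite ?mulrN1z ?row2_oppr.
  by rewrite oct_mul // nu_pm_oct_mem.
rewrite S_pmE // alb_map_albv !linear0 linearZ_LR m1E cmul1x.
have := cK cone; rewrite cmulx1 => ->; rewrite opprK -S_pmE // add0r.
have -> : a *~ ((-1) ^+ b *+ 2) = 0 by rewrite mulr2n mulrzDr row2_addrr.
by apply: (generator_mem him two0); constructor.
Qed.
End Translation.

Lemma realizable_lin (A : 'rV['Z_2]_3 -> 'rV['Z_2]_3) :
  {morph A : d e / d + e} -> injective A -> realizable (fun g => (g.1, A g.2)).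
Proof.
move=> AD Ainj; have A0 : A 0 = 0 by apply: (addrI (A 0)); rewrite -AD !addr0.
pose m (_ : 'Z_3) : endo := oct_lin im A.
apply: (realizable_triple (m := m)) => [i x y|i x y||d d0|b d|b].
- exact: oct_lin_polar.
- by rewrite /m /= oct_linM // !oct_lin_conj.
- by rewrite /= A0.
- rewrite nuE alb_map_albv !linear0 linearZ_LR -nuE /m /= oct_linE // nu_oct_mem //.
  by rewrite -A0 (inj_eq Ainj).
- rewrite nu_pmE alb_map_albv !linear0 !linearZ_LR /m /= oct_lin_conj // -nu_pmE.
  by rewrite oct_linE // nu_pm_oct_mem.
rewrite S_pmE // alb_map_albv !linear0 linearZ_LR /m /= oct_lin1 // -S_pmE // A0.
by apply: (generator_mem him two0); constructor.
Qed.

Lemma realizable_id : realizable id.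
Proof. by exists 1%g => g; rewrite /= lim1g. Qed.

(** Torsion is preserved, which yields A, and the image of (1, 0) is (s, a) with
   s invertible in Z; so u is a linear substitution followed by a translation
   and possibly by a change of sign. *)
Lemma realizable_zaut (u : zaut G) : realizable u.
Proof.
have uD := zaut_morph u; have u0 : u 0 = 0 by apply: (addrI (u 0)); rewrite -uD !addr0.
have uinj : injective u by exact: bij_inj (zaut_bij u).
have tor d : u (0, d) = (0, (u (0, d)).2).
  rewrite [LHS]surjective_pairing; congr (_, _).
  have : (u (0, d)).1 + (u (0, d)).1 = 0.
    rewrite -[LHS]/((u (0, d) + u (0, d)).1) -uD.
    by rewrite -[(0, d) + _]/(0, d + d) row2_addrr u0.
  by move/eqP; rewrite -mulr2n Num.Theory.mulrn_eq0 => /eqP.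
pose A d := (u (0, d)).2; pose a := (u (1, 0)).2; pose s := (u (1, 0)).1.
have AD : {morph A : d e / d + e}.
  by move=> d e; rewrite /A -[RHS]/((u (0, d) + u (0, e)).2) -uD.
have Ainj : injective A.
  move=> d e E; have : u (0, d) = u (0, e) by rewrite tor [RHS]tor; congr (_, _).
  by move/uinj => [].
have uE n d : u (n, d) = (s *~ n, A d + a *~ n).
  rewrite (morph_intpair uD) tor [LHS]surjective_pairing.
  by congr (_, _); rewrite raddfD raddfMz /= ?addr0 // addrC.
have sE : s = 1 \/ s = -1.
  have [v _ vK] := zaut_bij u; have := vK (1, 0); case: (v (1, 0)) => n d.
  rewrite uE mulrzz => -[/(congr1 absz)/eqP + _].
  rewrite abszM muln_eq1 => /andP [/eqP s1 _].
  by rewrite (intEsign s) s1 mulr1; case: (s < 0)%R; [right | left].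
have tr : realizable (fun g => (g.1, g.2 + a *~ g.1)).
  have [->|a0] := eqVneq a 0; last exact: realizable_translation.
  by apply: realizable_ext realizable_id => -[n d]; rewrite mul0rz addr0.
have R := realizable_comp tr (realizable_lin AD Ainj).
case: sE => sE.
  by apply: realizable_ext R => -[n d]; rewrite uE sE /= intz.
apply: realizable_ext (realizable_comp realizable_flip R) => -[n d].
by rewrite uE sE /= mulNrz intz.
Qed.

(** Realizing both u and its inverse bounds the dimension of each component by
   that of its image and conversely. *)
Lemma zaut_lift (u : zaut G) : exists f, forall g, (f @: Gamma g)%VS = Gamma (u g).
Proof.
have dimf f g : \dim (f @: Gamma g) = \dim (Gamma g).
  by rewrite limg_dim_eq // (eqP (algaut_inj f)) capv0.
have [f fu] := realizable_zaut u; have [f' fu'] := realizable_zaut (u^-1)%g.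
exists f => g; apply/eqP; rewrite eqEdim fu dimf.
by have := dimvS (fu' (u g)); rewrite dimf /= zaut_funK.
Qed.

Lemma weyl_zaut_surj (u : zaut G) : exists w, weyl_zaut him two0 w = u.
Proof.
have [f fu] := zaut_lift u.
have supp g : gsupp Gamma (u g) = gsupp Gamma g.
  by rewrite /gsupp -fu algaut_img_eq0.
have fP : f \in @gaut_pred _ _ (@amul F) _ Gamma.
  apply/asboolP; split=> g sg; first by exists (u g); rewrite ?supp.
  by exists (zaut_inv_fun u g); [rewrite -supp zaut_funVK | rewrite fu zaut_funVK].
exists (weyl_class (GAut fP)); apply: weyl_zaut_unique => g _; exact: fu.
Qed.

End Realization.

(* W(Gamma) is identified with a subgroup of Aut(Z x Z_2^3) by the injective
   homomorphism theta sending the class of phi to the automorphism u such that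
   phi(A_s) = A_(u s) for all s in the support; the theorem says that this
   subgroup is everything. *)
Theorem theorem4p6 (F : closedFieldType) (charF : 2%N \notin [pchar F])
    (im : F) (him : im ^+ 2 = -1) :
  exists theta : {multiplicative weyl (@amul F) (Gamma im) ->
                                  zaut (int * 'rV['Z_2]_3)%type},
    [/\ forall (phi : gaut (@amul F) (Gamma im)) (s : int * 'rV['Z_2]_3),
          gsupp (Gamma im) s ->
          (phi @: Gamma im s)%VS = Gamma im (theta (weyl_class phi) s),
        injective theta
      & forall u : zaut (int * 'rV['Z_2]_3)%type, exists w, theta w = u].
Proof.
have two0 : (2 : F) != 0 by apply: contra charF => E; rewrite inE /=.
exists (weyl_zaut him two0); split.
- by move=> phi s; apply: weyl_zautE.
- exact: weyl_zaut_inj.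
- exact: weyl_zaut_surj.
Qed.
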